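(* Let $M$ be a smooth manifold, $r\ge 0$ an integer, $(\tau,\omega)$ a doublet of class $2r+1$ on $M$ with $\tau\in\Omega^1(M)$ and $\omega\in\Omega^2(M)$, and $f\in C^\infty(M)$. Then the pair $(e^f\tau,\ e^f(df\wedge\tau+\omega))$ is a doublet of class $2r+1$ if and only if, for all Reeb vector fields $R$ of the doublet $(\tau,\omega)$, the function $f$ satisfies $$(\iota_R df)\,\tau\wedge\omega^r=df\wedge\omega^r.$$
   Context: The class of a pair $(\tau,\omega)$ of a 1-form and a 2-form at $x\in M$ is the codimension in $T_xM$ of $\operatorname{Ker}\tau_x\cap\operatorname{Ker}\omega_x$, where $\operatorname{Ker}\alpha_x=\{v\in T_xM\mid\iota_v\alpha_x=0\}$. A doublet is a pair whose class is constant on $M$. A Reeb vector field of $(\tau,\omega)$ is a vector field $R$ on $M$ with $\iota_R\tau=1$ and $\iota_R\omega=0$. $\omega^r$ is the exterior product of $r$ copies of $\omega$ (with $\omega^0=1$). *)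

(* Defs.v *)
From HB Require Import structures.
From mathcomp Require Import all_boot all_order all_algebra all_fingroup.
From mathcomp Require Import all_classical all_reals all_analysis.

Set Implicit Arguments.
Unset Strict Implicit.
Unset Printing Implicit Defensive.

Import Order.TTheory GRing.Theory Num.Theory.
Import numFieldNormedType.Exports.

Local Open Scope classical_set_scope.
Local Open Scope ring_scope.

Section smooth_functions.
Context {R : realType} {n : nat} {V : normedModType R}.

(* Values of f outside the open set U are irrelevant. *)
Fixpoint Ck (k : nat) (U : set 'rV[R]_n) (f : 'rV[R]_n -> V) : Prop :=
  (forall y, U y -> {for y, continuous f}) /\
  if k is k'.+1 then
    forall i : 'I_n,
      (forall y, U y -> derivable f y (delta_mx 0 i)) /\
      Ck k' U ('D_(delta_mx 0 i) f)
  else True.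

Definition smooth_on (U : set 'rV[R]_n) (f : 'rV[R]_n -> V) : Prop :=
  forall k, Ck k U f.

End smooth_functions.

(* Both maps of a chart are total; they are meaningful only on [dom] and on
   its image. *)
Record chart (R : realType) (n : nat) (T : topologicalType) := Chart {
  dom : set T ;
  coord : T -> 'rV[R]_n ;
  param : 'rV[R]_n -> T ;
  open_dom : open dom ;
  open_im : open (coord @` dom) ;
  coordK : forall x, dom x -> param (coord x) = x ;
  coord_cont : forall x, dom x -> {for x, continuous coord} ;
  param_cont : forall y, (coord @` dom) y -> {for y, continuous param}
}.

(* The smooth structure is given by an atlas, not necessarily maximal: an
   atlas and the maximal atlas containing it have the same smooth functions,
   vector fields and forms. *)
Record manifold (R : realType) (n : nat) := Manifold {
  carrier :> topologicalType ;
  manifold_hausdorff : hausdorff_space carrier ;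
  manifold_second_countable : @second_countable carrier ;
  atlas : set (chart R n carrier) ;
  atlas_cover : forall x : carrier, exists2 c, atlas c & dom c x ;
  atlas_smooth : forall c c', atlas c -> atlas c' ->
    smooth_on (coord c @` (dom c `&` dom c')) (coord c' \o param c)
}.

Section manifold_calculus.
Context {R : realType} {n : nat} {M : manifold R n}.

Definition chart_at (x : M) : chart R n M := s2val (cid2 (atlas_cover x)).

(* T_x M is 'rV[R]_n: a row is the vector with these components in the
   coordinate basis of the preferred chart [chart_at x].  The components of
   v : T_x M in another chart c around x are v *m change (chart_at x) c x. *)
Definition change (c c' : chart R n M) (x : M) : 'M[R]_n :=
  'J (coord c' \o param c) (coord c x).

Definition smooth (f : M -> R) : Prop :=
  forall c, atlas c -> smooth_on (coord c @` dom c) (f \o param c).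

Definition vector_field := forall x : M, 'rV[R]_n.

Definition smooth_field (X : vector_field) : Prop :=
  forall c, atlas c -> smooth_on (coord c @` dom c)
    (fun y => let x := param c y in X x *m change (chart_at x) c x).

(* A k-tuple of vectors of T_x M is the k x n matrix having them as rows.  In
   particular a 1-form is evaluated directly on a vector, and a 0-form is
   evaluated on the only 0 x n matrix. *)
Definition form_family (k : nat) := forall x : M, 'M[R]_(k, n) -> R.

Definition multilinear k (a : 'M[R]_(k, n) -> R) : Prop :=
  forall (i : 'I_k) (s : R) (A B C : 'M[R]_(k, n)),
    row i A = s *: row i B + row i C ->
    (forall j, j != i -> row j B = row j A) ->
    (forall j, j != i -> row j C = row j A) ->
    a A = s * a B + a C.

Definition alternating k (a : 'M[R]_(k, n) -> R) : Prop :=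
  forall (i j : 'I_k) (A : 'M[R]_(k, n)), i != j -> row i A = row j A -> a A = 0.

(* In the last clause the rows of A are the (constant) components of k
   coordinate vector fields in the chart c. *)
Definition is_form k (a : form_family k) : Prop :=
  (forall x, multilinear (a x) /\ alternating (a x)) /\
  (forall c, atlas c -> forall A : 'M[R]_(k, n),
    smooth_on (coord c @` dom c)
      (fun y => let x := param c y in a x (A *m change c (chart_at x) x))).

Definition unit_form : form_family 0 := fun _ _ => 1.

Definition form_add k (a b : form_family k) : form_family k :=
  fun x A => a x A + b x A.

Definition form_scale k (g : M -> R) (a : form_family k) : form_family k :=
  fun x A => g x * a x A.

Definition differential (f : M -> R) : form_family 1 :=
  fun x v => 'd (f \o param (chart_at x)) (coord (chart_at x) x) v.

(* Normalised so that (a /\ b)(v, w) = a(v) b(w) - a(w) b(v) for 1-forms. *)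
Definition wedge p q (a : form_family p) (b : form_family q) :
    form_family (p + q) :=
  fun x A => (p`!%:R * q`!%:R)^-1 *
    \sum_(s : 'S_(p + q)) (-1) ^+ s *
      a x (usubmx (row_perm s A)) * b x (dsubmx (row_perm s A)).

Fixpoint wedge_pow k (a : form_family k) (r : nat) : form_family (r * k) :=
  match r return form_family (r * k) with
  | 0 => unit_form
  | r'.+1 => wedge a (@wedge_pow k a r')
  end.

Definition contract k (v : 'rV[R]_n) (a : 'M[R]_(1 + k, n) -> R) :
    'M[R]_(k, n) -> R :=
  fun A => a (col_mx v A).

Definition Ker k (a : 'M[R]_(1 + k, n) -> R) : set 'rV[R]_n :=
  [set v | forall A, contract v a A = 0].

Definition has_codim (S : set 'rV[R]_n) (c : nat) : Prop :=
  exists2 K : {vspace 'rV[R]_n},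
    S = [set v | v \in K] & (\dim K + c)%N = \dim {:'rV[R]_n}.

Definition doublet_of_class (c : nat)
    (tau : form_family 1) (omega : form_family 2) : Prop :=
  [/\ is_form tau, is_form omega &
      forall x, has_codim (Ker (k := 0) (tau x) `&` Ker (k := 1) (omega x)) c].

Definition reeb (tau : form_family 1) (omega : form_family 2)
    (X : vector_field) : Prop :=
  [/\ smooth_field X, forall x, tau x (X x) = 1 &
      forall x A, contract (k := 1) (X x) (omega x) A = 0].

End manifold_calculus.

Arguments vector_field {R n} M.
Arguments form_family {R n} M k.
Arguments wedge_pow {R n M k} a r.

(* Main.v *)
Require Import Defs.
From HB Require Import structures.
From mathcomp Require Import all_boot all_order all_algebra all_fingroup.
From mathcomp Require Import all_classical all_reals all_analysis.
From mathcomp Require Import ring lra zify.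
Import Defs.

(** The equivalence is pointwise linear algebra, plus the existence of one Reeb
    vector field.

    Fix a point x, write a for df at x, and let K be the intersection of Ker tau
    and Ker omega in the tangent space.  Both conditions say that a vanishes on
    K.  For the class, the kernel of the new pair is K intersected with Ker a
    ([pointwise_class]), which has the dimension of K iff it is K.  For the
    equation, the odd class 2r + 1 forces omega to have rank 2r, since the rank of
    an alternating form is even ([rank_gram]); so Ker omega is spanned by K and a
    Reeb vector X ([reeb_vector]), and (a - a(X) tau) /\ omega^r = 0 iff
    a - a(X) tau vanishes on Ker omega ([pointwise_equation]).  The last
    equivalence rests on two facts: an alternating form of degree 2r + 1 which is
    induced from the quotient by Ker omega vanishes ([alternating_eq0_of_rank]),
    and omega^r is not zero ([wedge_pow_at_neq0]).

    The direction from the equation to the class quantifies over global Reeb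
    fields, and would be void without one.  In a chart the equations of a Reeb
    field are a linear system of constant rank, solved smoothly by Cramer's rule
    ([local_reebP]).  A bump function extends the solutions to M
    ([exists_local_reeb]), countably many of them suffice ([semi_reeb_cover]),
    and a sum with flat weights glues them ([exists_reeb]).

    The remaining parts supply the calculus: a function with continuous partial
    derivatives is differentiable ([C1_differentiable]), smooth functions are
    closed under the usual operations and under composition ([Ck_comp1],
    [Ck_comp]), and the function exp(-1/t) extended by zero is smooth
    ([smooth_on_flat]).  They also show that the new pair consists of smooth
    forms. *)

Set Implicit Arguments.
Unset Strict Implicit.
Unset Printing Implicit Defensive.

Import Order.TTheory GRing.Theory Num.Theory.
Import numFieldNormedType.Exports.

Local Open Scope ring_scope.

(** * Alternating sums over permutations *)

Section AlternatingSums.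
Context {R : realType} {n : nat}.

(** The signed sum over permutations that defines the wedge product, for an
    arbitrary F.  Its behaviour under permutations and under fixing one argument
    does not require F to be multilinear, so the combinatorics is done here. *)
Definition altsum m (F : 'M[R]_(m, n) -> R) (A : 'M[R]_(m, n)) : R :=
  \sum_(s : 'S_m) (-1) ^+ s * F (row_perm s A).

Definition antisym m (F : 'M[R]_(m, n) -> R) : Prop :=
  forall (s : 'S_m) A, F (row_perm s A) = (-1) ^+ s * F A.

Definition tensor p q (a : 'M[R]_(p, n) -> R) (b : 'M[R]_(q, n) -> R) :
    'M[R]_(p + q, n) -> R :=
  fun A => a (usubmx A) * b (dsubmx A).

Lemma row_row_perm m (s : 'S_m) (A : 'M[R]_(m, n)) i :
  row i (row_perm s A) = row (s i) A.
Proof. by apply/rowP => j; rewrite !mxE. Qed.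

(** Right translation by t reindexes the symmetric group and multiplies the
    signs by that of t. *)
Lemma altsum_antisym m (F : 'M[R]_(m, n) -> R) : antisym (altsum F).
Proof.
move=> t A; rewrite /altsum mulr_sumr [RHS](reindex_inj (mulIg t)) /=.
apply: eq_bigr => s _; rewrite -row_permM odd_permM signr_addb.
by rewrite mulrA mulrCA -expr2 sqrr_sign mulr1.
Qed.

(** Exchanging two equal arguments changes the sign and nothing else, and R has
    characteristic 0. *)
Lemma antisym_alternating m (F : 'M[R]_(m, n) -> R) : antisym F -> alternating F.
Proof.
move=> Fanti i j A ij rij.
have : F (row_perm (tperm i j) A) = F A.
  congr F; apply/row_matrixP => k; rewrite row_row_perm.
  by case: tpermP => [->|->|].
rewrite Fanti odd_tperm ij expr1 mulN1r => /eqP.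
by rewrite eq_sym -addr_eq0 -mulr2n mulrn_eq0 /= => /eqP.
Qed.

Lemma altsum_of_antisym m (F : 'M[R]_(m, n) -> R) A :
  antisym F -> altsum F A = m`!%:R * F A.
Proof.
move=> Fanti; rewrite /altsum (eq_bigr (fun=> F A)) => [|s _].
  by rewrite sumr_const mulr_natl; congr (_ *+ _); exact: card_Sn.
by rewrite Fanti mulrA -signr_addb addbb mul1r.
Qed.

(** The cycle by which [row_perm] moves row 0 down to position i. *)
Definition cycle_perm m (i : 'I_(1 + m)) : 'S_(1 + m) := lift_perm i ord0 1.

Lemma cycle_permE m (i k : 'I_(1 + m)) :
  cycle_perm i k = (if (k < i)%N then k.+1 else if k == i then 0 else k)%N :> nat.
Proof.
rewrite /cycle_perm; case: (unliftP i k) => [k'|] ->; last first.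
  by rewrite lift_perm_id ltnn eqxx.
rewrite lift_perm_lift perm1 eq_sym (negPf (neq_lift _ _)) /= /bump.
by case: (leqP i k') => h; rewrite /= ?add1n ?add0n; [rewrite ltnNge (leqW h)|rewrite h].
Qed.

Lemma sign_cycle_perm m (i : 'I_(1 + m)) : (-1) ^+ cycle_perm i = (-1) ^+ i :> R.
Proof. by rewrite /cycle_perm odd_lift_perm odd_perm1 addbF /= addbF signr_odd. Qed.

(** Indexing rows by natural numbers makes the access insensitive to the way in
    which the number of rows is written as a sum, so that matrices of
    convertible but different types can be compared row by row.  Indices out of
    range give 0, which keeps most of the rules below unconditional. *)
Definition nth_row m (A : 'M[R]_(m, n)) (k : nat) : 'rV[R]_n :=
  oapp (fun i : 'I_m => row i A) 0 (insub k).

Lemma nth_rowE m (A : 'M[R]_(m, n)) (i : 'I_m) : nth_row A i = row i A.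
Proof. by rewrite /nth_row valK. Qed.

Lemma nth_row_out m (A : 'M[R]_(m, n)) k : (m <= k)%N -> nth_row A k = 0.
Proof. by move=> mk; rewrite /nth_row insubF //= ltnNge mk. Qed.

Lemma nth_rowP m (A B : 'M[R]_(m, n)) :
  (forall k, (k < m)%N -> nth_row A k = nth_row B k) -> A = B.
Proof. by move=> h; apply/row_matrixP => i; rewrite -!nth_rowE h. Qed.

Lemma nth_row_usubmx p q (A : 'M[R]_(p + q, n)) k : (k < p)%N -> nth_row (usubmx A) k = nth_row A k.
Proof.
move=> kp; rewrite (nth_rowE _ (Ordinal kp)) -[k in RHS]/(nat_of_ord (lshift q (Ordinal kp))) nth_rowE.
by apply/rowP => j; rewrite !mxE.
Qed.

Lemma nth_row_dsubmx p q (A : 'M[R]_(p + q, n)) k :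
  nth_row (dsubmx A) k = nth_row A (p + k).
Proof.
have [kp|qk] := ltnP k q; last by rewrite !nth_row_out // leq_add2l.
rewrite (nth_rowE _ (Ordinal kp)) -[(p + k)%N]/(nat_of_ord (rshift p (Ordinal kp))) nth_rowE.
by apply/rowP => j; rewrite !mxE.
Qed.

Lemma nth_row_col_mx p q (A : 'M[R]_(p, n)) (B : 'M[R]_(q, n)) k : (k < p + q)%N ->
  nth_row (col_mx A B) k = if (k < p)%N then nth_row A k else nth_row B (k - p).
Proof.
move=> kpq; case: ltnP => kp.
  by rewrite -(@nth_row_usubmx p q) // col_mxKu.
by rewrite -{1}(subnKC kp) -nth_row_dsubmx col_mxKd.
Qed.

Lemma nth_row_perm m (s : 'S_m) (A : 'M[R]_(m, n)) (k : 'I_m) :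
  nth_row (row_perm s A) k = nth_row A (s k).
Proof. by rewrite !nth_rowE row_row_perm. Qed.

Lemma nth_row_cycle_perm m (i : 'I_(1 + m)) (A : 'M[R]_(1 + m, n)) k : (k < 1 + m)%N ->
  nth_row (row_perm (cycle_perm i) A) k =
  nth_row A (if (k < i)%N then k.+1 else if k == i then 0%N else k).
Proof. by move=> km; rewrite (nth_row_perm _ _ (Ordinal km)) cycle_permE. Qed.

Lemma nth_row_row (v : 'rV[R]_n) : nth_row v 0 = v.
Proof. by rewrite (nth_rowE v ord0); apply/rowP => j; rewrite !mxE. Qed.

Lemma row_perm_lift0 m (s : 'S_m) (v : 'rV[R]_n) (A : 'M[R]_(m, n)) :
  row_perm (lift_perm ord0 ord0 s : 'S_(1 + m)) (col_mx v A) = col_mx v (row_perm s A).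
Proof.
apply: nth_rowP => -[|k] km; rewrite (nth_row_perm _ _ (Ordinal km)) !nth_row_col_mx //=.
  have -> : Ordinal km = ord0 by apply/val_inj.
  by rewrite lift_perm_id.
have -> : Ordinal km = lift ord0 (Ordinal (km : (k < m)%N)) by apply/val_inj.
by rewrite lift_perm_lift /= !subSS !subn0 -nth_row_perm.
Qed.

Definition insert_row m (i : 'I_(1 + m)) (v : 'rV[R]_n) (A : 'M[R]_(m, n)) : 'M[R]_(1 + m, n) :=
  row_perm (cycle_perm i) (col_mx v A).

(** Expansion along the first argument: a permutation of 1 + m rows is the choice
    of the position i which receives row 0, at the cost of a cycle of sign
    (-1)^i, together with a permutation of the other m rows. *)
Lemma altsum_col_mx m (F : 'M[R]_(1 + m, n) -> R) v A :
  altsum F (col_mx v A) = \sum_(i < 1 + m) (-1) ^+ i * altsum (fun B => F (insert_row i v B)) A.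
Proof.
rewrite /altsum; under [RHS]eq_bigr do rewrite mulr_sumr.
rewrite pair_big /=.
pose g (u : 'I_(1 + m) * 'S_m) : 'S_(1 + m) := lift_perm u.1 ord0 u.2.
have ginj : injective g.
  move=> [i s] [j t] /= e.
  have ij : i = j.
    apply: (@perm_inj _ (g (i, s))); rewrite {2}e /g /= !lift_perm_id //.
  subst j; congr pair; apply/permP => k.
  have := congr1 (fun u : 'S_(1 + m) => u (lift i k)) e.
  by rewrite /g /= !lift_perm_lift => /lift_inj.
have gbij : bijective g.
  apply: inj_card_bij => //.
  by rewrite card_prod card_ord !card_Sn factS.
rewrite (reindex g) /=; last exact: onW_bij.
apply: eq_bigr => -[i s] _ /=; rewrite /g /= mulrA; congr (_ * F _).
  by rewrite odd_lift_perm /= addbF signr_addb signr_odd.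
by rewrite /insert_row -row_perm_lift0 -row_permM /cycle_perm lift_permM mul1g.
Qed.

End AlternatingSums.

(** * Two arguments of an alternating sum *)

Section Wedge.
Context {R : realType} {n : nat}.

Lemma nth_row_insert m (i : 'I_(1 + m)) (v : 'rV[R]_n) (A : 'M[R]_(m, n)) k :
  nth_row (insert_row i v A) k =
  if (k < i)%N then nth_row A k else if (k == i)%N then v else nth_row A k.-1.
Proof.
have i_lt := ltn_ord i.
have [km|mk] := ltnP k (1 + m); last first.
  have -> : (k < i)%N = false by lia.
  have -> : (k == i)%N = false by lia.
  by rewrite !nth_row_out //; lia.
rewrite nth_row_cycle_perm //; case: ltngtP => ki.
- by rewrite nth_row_col_mx /=; [rewrite subn1|lia].
- rewrite nth_row_col_mx //; case: ltnP => k1; first by lia.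
  by rewrite subn1.
- by rewrite nth_row_col_mx // nth_row_row.
Qed.

Lemma antisym_insert_row m (G : 'M[R]_(1 + m, n) -> R) i v A : antisym G ->
  G (insert_row i v A) = (-1) ^+ i * G (col_mx v A).
Proof. by move=> Ganti; rewrite Ganti sign_cycle_perm. Qed.

Lemma eq_altsum m (F G : 'M[R]_(m, n) -> R) A :
  (forall s : 'S_m, F (row_perm s A) = G (row_perm s A)) -> altsum F A = altsum G A.
Proof. by move=> FG; apply: eq_bigr => s _; rewrite FG. Qed.

Lemma altsumZ m (F : 'M[R]_(m, n) -> R) c A :
  altsum (fun B => c * F B) A = c * altsum F A.
Proof. by rewrite /altsum mulr_sumr; apply: eq_bigr => s _; rewrite mulrCA. Qed.

Lemma altsum_eq0 m (F : 'M[R]_(m, n) -> R) A :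
  (forall s : 'S_m, F (row_perm s A) = 0) -> altsum F A = 0.
Proof. by move=> F0; apply: big1 => s _; rewrite F0 mulr0. Qed.

Lemma col_mx_nth_row (A : 'M[R]_(2, n)) : A = col_mx (nth_row A 0) (nth_row A 1).
Proof.
by apply: (@nth_rowP _ _ 2) => -[|[|//]] k2; rewrite (@nth_row_col_mx _ _ 1 1) //= ?subnn nth_row_row.
Qed.

Definition orthog m (w : 'M[R]_(2, n) -> R) (v : 'rV[R]_n) (A : 'M[R]_(m, n)) :=
  forall k, (k < m)%N -> w (col_mx v (nth_row A k)) = 0.

Lemma orthog_perm m w v (A : 'M[R]_(m, n)) s : orthog w v A -> orthog w v (row_perm s A).
Proof. by move=> o k km; rewrite (nth_row_perm _ _ (Ordinal km)) o. Qed.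

Lemma orthog_dsub p q w v (A : 'M[R]_(p + q, n)) : orthog w v A -> orthog w v (dsubmx A).
Proof. by move=> o k km; rewrite nth_row_dsubmx o //; lia. Qed.

Lemma antisym2 (w : 'M[R]_(2, n) -> R) (u v : 'rV[R]_n) :
  antisym w -> w (col_mx u v) = - w (col_mx v u).
Proof.
move=> wanti; rewrite -mulN1r -[-1]expr1.
rewrite -(@antisym_insert_row 1 w (lift ord0 ord0) v u) //; congr w.
by apply: (@nth_rowP _ _ 2) => -[|[|//]] k2; rewrite nth_row_insert (@nth_row_col_mx _ _ 1 1) //= ?subnn nth_row_row.
Qed.

(** In the alternating sum defining (w /\ G)(e, f, A), with e and f orthogonal
    to A and w(e, f) = 1, the vectors e and f are placed in positions i and j.
    The terms survive only if both go to the arguments of w or both go to the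
    arguments of G. *)
Section Pair.
Variables (w : 'M[R]_(2, n) -> R) (e f : 'rV[R]_n).
Hypotheses (wanti : antisym w) (wef : w (col_mx e f) = 1).

Let worth (v u : 'rV[R]_n) : w (col_mx v u) = 0 -> w (col_mx u v) = 0.
Proof. by move=> h; rewrite antisym2 // h oppr0. Qed.

Variables (q : nat) (G : 'M[R]_(q, n) -> R).
Hypothesis Ganti : antisym G.
Variables (i : 'I_(2 + q)) (j : 'I_(1 + q)) (D : 'M[R]_(q, n)).
Hypotheses (eD : orthog w e D) (fD : orthog w f D).

Let X : 'M[R]_(2 + q, n) := insert_row i e (insert_row j f D).

Let usubX : usubmx X = col_mx (nth_row X 0) (nth_row X 1).
Proof. by rewrite [LHS]col_mx_nth_row !nth_row_usubmx. Qed.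

Lemma tensor_pair_head : (i <= 1)%N -> j = 0%N :> nat ->
  tensor w G X = (-1) ^+ i * G D.
Proof.
move=> i1 j0; rewrite /tensor usubX /X !nth_row_insert //=. rewrite j0 /=.
have -> : dsubmx (insert_row i e (insert_row j f D) : 'M[R]_(2 + q, n)) = D.
  apply: nth_rowP => k kq; rewrite nth_row_dsubmx // nth_row_insert.
  have -> : (2 + k < i)%N = false by lia.
  have -> : (2 + k == i)%N = false by lia.
  by rewrite nth_row_insert j0.
have [->|->] : (i = 0%N :> nat) \/ (i = 1%N :> nat) by lia.
  by rewrite /= wef ?expr0 ?mul1r.
by rewrite /= antisym2 // wef ?expr1.
Qed.

Lemma tensor_pair_split1 : (i <= 1)%N -> (0 < j)%N -> tensor w G X = 0.
Proof.
move=> i1 j0; rewrite /tensor usubX /X; have jq := ltn_ord j; rewrite !nth_row_insert //=.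
have [->|->] : (i = 0%N :> nat) \/ (i = 1%N :> nat) by lia.
  by rewrite /= j0 eD ?mul0r //; lia.
by rewrite /= j0 worth ?mul0r // eD //; lia.
Qed.

Lemma tensor_pair_split2 : (1 < i)%N -> (j <= 1)%N -> tensor w G X = 0.
Proof.
move=> i1 j0; have iq := ltn_ord i; rewrite /tensor usubX /X !nth_row_insert //=.
rewrite (ltnW i1) i1.
have [->|->] : (j = 0%N :> nat)%N \/ (j = 1%N :> nat) by lia.
  by rewrite /= fD ?mul0r //; lia.
by rewrite /= worth ?mul0r // fD //; lia.
Qed.

End Pair.

Lemma tensor_pair_tail (w : 'M[R]_(2, n) -> R) q (G : 'M[R]_(2 + q, n) -> R)
    e f (i : 'I_(2 + (2 + q))) (j : 'I_(1 + (2 + q))) (D : 'M[R]_(2 + q, n)) :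
  antisym G -> (1 < i)%N -> (1 < j)%N ->
  tensor w G (insert_row i e (insert_row j f D) : 'M[R]_(2 + (2 + q), n)) =
  (-1) ^+ i * (-1) ^+ j * tensor w (fun B : 'M[R]_(q, n) => G (col_mx e (col_mx f B))) D.
Proof.
move=> Ganti i1 j1; have iq := ltn_ord i; have jq := ltn_ord j.
have i'P : (i - 2 < 1 + (1 + q))%N by lia.
have j'P : (j - 2 < 1 + q)%N by lia.
rewrite /tensor.
have -> : usubmx (insert_row i e (insert_row j f D) : 'M[R]_(2 + (2 + q), n)) = usubmx D.
  apply: nth_rowP => k k2; rewrite !nth_row_usubmx // !nth_row_insert //=.
  have -> : (k < i)%N by lia.
  by have -> : (k < j)%N by lia.
have -> : dsubmx (insert_row i e (insert_row j f D) : 'M[R]_(2 + (2 + q), n)) =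
    insert_row (Ordinal i'P) e (insert_row (Ordinal j'P) f (dsubmx D)).
  apply: (@nth_rowP _ _ (2 + q)) => k kq; rewrite nth_row_dsubmx // nth_row_insert.
  rewrite [RHS]nth_row_insert //=.
  have -> : (2 + k < i)%N = (k < i - 2)%N by lia.
  have -> : (2 + k == i)%N = (k == i - 2)%N by lia.
  case: ltngtP => // ki.
  - rewrite !nth_row_insert //=.
    have -> : (2 + k < j)%N = (k < j - 2)%N by lia.
    have -> : (2 + k == j)%N = (k == j - 2)%N by lia.
    case: ltngtP => // kj.
      by rewrite nth_row_dsubmx.
    by rewrite nth_row_dsubmx; congr (nth_row D _); lia.
  - rewrite !nth_row_insert //=.
    have -> : (k.+1 < j)%N = (k.-1 < j - 2)%N by lia.
    have -> : (k.+1 == j)%N = (k.-1 == j - 2)%N by lia.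
    case: ltngtP => // kj.
      by rewrite nth_row_dsubmx; congr (nth_row D _); lia.
    by rewrite nth_row_dsubmx; congr (nth_row D _); lia.
rewrite (@antisym_insert_row (1 + q)%N G _ _ _ Ganti).
have antiGe : antisym (fun B : 'M[R]_(1 + q, n) => G (col_mx e B)).
  by move=> s B; rewrite -row_perm_lift0 Ganti odd_lift_perm.
rewrite (antisym_insert_row (Ordinal j'P) f (dsubmx D) antiGe) /=.
have sg a : (1 < a)%N -> (-1) ^+ (a - 2) = (-1) ^+ a :> R.
  by move=> a1; rewrite -[in RHS](subnK a1) exprD sqrrN expr1n mulr1.
by rewrite !sg // mulrCA -[RHS]mulrA; congr (_ * _); exact: mulrCA.
Qed.

End Wedge.

(** * Powers of a 2-form at a point *)

Section WedgeAt.
Context {R : realType} {n : nat}.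
Implicit Types (w : 'M[R]_(2, n) -> R).

Definition wedge_at p q (a : 'M[R]_(p, n) -> R) (b : 'M[R]_(q, n) -> R) :
    'M[R]_(p + q, n) -> R :=
  fun A => (p`!%:R * q`!%:R)^-1 * altsum (tensor a b) A.

Fixpoint wedge_pow_at w r : 'M[R]_(r * 2, n) -> R :=
  match r return 'M[R]_(r * 2, n) -> R with
  | 0 => fun _ => 1
  | r'.+1 => wedge_at w (@wedge_pow_at w r')
  end.

Arguments wedge_pow_at w r _ : clear implicits.

Lemma wedge_at_antisym p q (a : 'M[R]_(p, n) -> R) (b : 'M[R]_(q, n) -> R) :
  antisym (wedge_at a b).
Proof. by move=> s A; rewrite /wedge_at altsum_antisym mulrCA. Qed.

Lemma wedge_pow_at_antisym w r : antisym (wedge_pow_at w r).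
Proof.
case: r => [|r] s A; last exact: (@wedge_at_antisym 2 (r * 2)).
have -> : s = 1%g by apply/permP; case.
by rewrite row_perm1 odd_perm1 mul1r.
Qed.

Lemma wedge_pow_atS w r A : wedge_pow_at w r.+1 A = (2 * (r * 2)`!%:R)^-1 * altsum (tensor w (wedge_pow_at w r)) A.
Proof. by []. Qed.

Lemma altsum_col_mx2 w q (G : 'M[R]_(q, n) -> R) (e f : 'rV[R]_n) (A : 'M[R]_(q, n)) :
  altsum (tensor w G) (col_mx e (col_mx f A) : 'M[R]_(2 + q, n)) =
  \sum_(i < 2 + q) \sum_(j < 1 + q) (-1) ^+ i * (-1) ^+ j *
     altsum (fun D => tensor w G (insert_row i e (insert_row j f D) : 'M[R]_(2 + q, n))) A.
Proof.
rewrite [LHS](@altsum_col_mx _ _ (1 + q)); apply: eq_bigr => i _.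
by rewrite altsum_col_mx mulr_sumr; apply: eq_bigr => j _; rewrite mulrA.
Qed.

Lemma orthog0 w v (A : 'M[R]_(0, n)) : orthog w v A.
Proof. by []. Qed.

Lemma pair_count_head q :
  \sum_(i < 2 + (2 + q)) \sum_(j < 1 + (2 + q))
    ((i <= 1) && (j == 0%N :> nat))%N%:R = 2 :> R.
Proof.
rewrite !big_ord_recl /= !big1 => [|i _|i _]; rewrite ?big1 //= !(addr0, add0r) ?natr1 //.
Qed.

Lemma pair_count_tail q :
  \sum_(i < 2 + (2 + q)) \sum_(j < 1 + (2 + q))
    ((1 < i) && (1 < j))%N%:R = ((2 + q) * (1 + q))%:R :> R.
Proof.
rewrite big_split_ord /= [X in X + _]big1 ?add0r; last first.
  by move=> i _; apply: big1 => j _; rewrite ltnNge -ltnS ltn_ord.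
rewrite (eq_bigr (fun=> (1 + q)%:R)) => [|i _].
  by rewrite sumr_const card_ord -mulrnA mulnC.
rewrite (@big_split_ord _ _ _ 2 (1 + q)%N) /= [X in X + _]big1 ?add0r; last first.
  by move=> j _ /=; rewrite [(1 < j)%N]ltnNge -ltnS ltn_ord.
by rewrite (eq_bigr (fun=> 1)) // sumr_const card_ord.
Qed.

(** If e and f both go to the first factor of w /\ w^r, they contribute w^r(A);
    otherwise they both go to the factor w^r, where induction applies to them and
    gives r w^r(A) in total. *)
Lemma wedge_pow_at_pair w r (e f : 'rV[R]_n) (A : 'M[R]_(r * 2, n)) :
  antisym w -> w (col_mx e f) = 1 -> orthog w e A -> orthog w f A ->
  wedge_pow_at w r.+1 (col_mx e (col_mx f A) : 'M[R]_(2 + r * 2, n)) = r.+1%:R * wedge_pow_at w r A.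
Proof.
move=> wanti wef; elim: r A => [|r IH] A eA fA.
  rewrite wedge_pow_atS altsum_col_mx2 !big_ord_recl !big_ord0 /=.
  rewrite [X in _ * (X + _ + _)](_ : _ = wedge_pow_at w 0 A); last first.
    rewrite (@eq_altsum _ _ _ _ (fun D => wedge_pow_at w 0 D)).
      by rewrite altsum_of_antisym ?mulr1 ?mul1r //; exact: wedge_pow_at_antisym.
    by move=> s; rewrite tensor_pair_head // expr0 mul1r.
  rewrite (@eq_altsum _ _ _ _ (fun D => (-1) ^+ 1 * wedge_pow_at w 0 D)); last first.
    by move=> s; rewrite tensor_pair_head //; exact: orthog0.
  rewrite altsumZ altsum_of_antisym; last exact: wedge_pow_at_antisym.
  rewrite /= /bump /=; rewrite fact0 !expr0 !expr1. rewrite ?mulr1 ?addr0 mulrNN ?mulr1.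
  by rewrite -mulr2n mulVf // pnatr_eq0.
set q := (r * 2)%N in A eA fA IH *.
set G := wedge_pow_at w r.+1.
have Ganti : antisym G by exact: wedge_pow_at_antisym.
pose a := (2 + q)`!%:R * G A.
pose b := altsum (tensor w (fun B : 'M[R]_(q, n) => G (col_mx e (col_mx f B) : 'M[R]_(2 + q, n)))) A.
have -> : wedge_pow_at w r.+2 (col_mx e (col_mx f A) : 'M[R]_(2 + (2 + q), n)) =
   (2 * (2 + q)`!%:R)^-1 * altsum (tensor w G) (col_mx e (col_mx f A) : 'M[R]_(2 + (2 + q), n)).
  by [].
have eb : b = r.+1%:R * (2 * q`!%:R) * G A.
  rewrite /b (@eq_altsum _ _ _ _ (fun D => r.+1%:R * tensor w (wedge_pow_at w r) D)).
    rewrite altsumZ /G wedge_pow_atS -/q -[RHS]mulrA mulVKf // mulf_neq0 ?pnatr_eq0 -?lt0n ?fact_gt0.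
  move=> s; rewrite /tensor /G IH 1?mulrCA //; apply: orthog_dsub; exact: orthog_perm.
rewrite altsum_col_mx2.
transitivity ((2 * (2 + q)`!%:R)^-1 * \sum_(i < 2 + (2 + q)) \sum_(j < 1 + (2 + q))
   (((i <= 1) && (j == 0%N :> nat))%N%:R * a + ((1 < i) && (1 < j))%N%:R * b)).
  congr (_ * _); apply: eq_bigr => i _; apply: eq_bigr => j _.
  have [i1|i1] := leqP i 1.
    rewrite mul0r addr0; case: eqP => j0.
      rewrite mul1r (@eq_altsum _ _ _ _ (fun D => (-1) ^+ i * G D)); last first.
        by move=> s; rewrite tensor_pair_head //; exact: orthog_perm.
      by rewrite altsumZ j0 expr0 mulr1 mulrA -expr2 sqrr_sign mul1r altsum_of_antisym.
    rewrite mul0r altsum_eq0 ?mulr0 // => s.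
    by rewrite tensor_pair_split1 //; [exact: orthog_perm|rewrite lt0n; apply/eqP].
  rewrite mul0r add0r; have [j1|j1] := leqP j 1.
    rewrite mul0r altsum_eq0 ?mulr0 // => s.
    by rewrite tensor_pair_split2 //; exact: orthog_perm.
  rewrite mul1r (@eq_altsum _ _ _ _ (fun D => (-1) ^+ i * (-1) ^+ j * tensor w (fun B : 'M[R]_(q, n) => G (col_mx e (col_mx f B))) D)); last first.
    by move=> s; rewrite tensor_pair_tail.
  by rewrite altsumZ mulrA -expr2 exprMn !sqrr_sign !mul1r.
under eq_bigr do rewrite big_split /= -!mulr_suml.
rewrite big_split /= -!mulr_suml.
rewrite pair_count_head pair_count_tail eb /a.
have fq : (2 + q)`! = ((2 + q) * (1 + q) * q`!)%N by rewrite !factS mulnA.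
have q0 : q`!%:R != 0 :> R by rewrite pnatr_eq0 -lt0n fact_gt0.
have q1 : (1 + q)%:R != 0 :> R by rewrite pnatr_eq0.
have q2 : (2 + q)%:R != 0 :> R by rewrite pnatr_eq0.
rewrite fq !natrM [r.+2%:R]mulrS; move: (G A) (r.+1%:R : R) q0 q1 q2.
move: (q`!%:R : R) ((1 + q)%:R : R) ((2 + q)%:R : R) => x y z g s x0 y0 z0.
by field; rewrite x0 y0 z0.
Qed.

End WedgeAt.

Arguments wedge_pow_at {R n} w r _.

(** * Multilinear alternating functions *)

Section Multilinear.
Context {R : realType} {n : nat}.

Lemma multilinear_tensor p q (a : 'M[R]_(p, n) -> R) (b : 'M[R]_(q, n) -> R) :
  multilinear a -> multilinear b -> multilinear (tensor a b).
Proof.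
move=> amul bmul i s A B C rA rB rC.
have ur (X : 'M[R]_(p + q, n)) k : row k (usubmx X) = row (lshift q k) X.
  by apply/rowP => l; rewrite !mxE.
have dr (X : 'M[R]_(p + q, n)) k : row k (dsubmx X) = row (rshift p k) X.
  by apply/rowP => l; rewrite !mxE.
rewrite /tensor; case: (split_ordP i) => k ik.
  have dE (X : 'M[R]_(p + q, n)) : (forall j, j != i -> row j X = row j A) -> dsubmx X = dsubmx A.
    move=> h; apply/row_matrixP => j; rewrite !dr h // ik -(inj_eq val_inj) /=.
    by have := ltn_ord k; lia.
  rewrite (amul k s (usubmx A) (usubmx B) (usubmx C)) ?(dE B) ?(dE C) ?mulrDl ?mulrA //.
  - by rewrite !ur -ik.
  - by move=> j jk; rewrite !ur rB // ik (inj_eq (@lshift_inj _ _)).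
  - by move=> j jk; rewrite !ur rC // ik (inj_eq (@lshift_inj _ _)).
have uE (X : 'M[R]_(p + q, n)) : (forall j, j != i -> row j X = row j A) -> usubmx X = usubmx A.
  move=> h; apply/row_matrixP => j; rewrite !ur h // ik -(inj_eq val_inj) /=.
  by have := ltn_ord j; lia.
rewrite (bmul k s (dsubmx A) (dsubmx B) (dsubmx C)) ?(uE B) ?(uE C) ?mulrDr ?[_ * (s * _)]mulrCA //.
- by rewrite !dr -ik.
- by move=> j jk; rewrite !dr rB // ik (inj_eq (@rshift_inj _ _)).
- by move=> j jk; rewrite !dr rC // ik (inj_eq (@rshift_inj _ _)).
Qed.

Lemma multilinear_altsum m (F : 'M[R]_(m, n) -> R) : multilinear F -> multilinear (altsum F).
Proof.
move=> Fmul i c A B C rA rB rC; rewrite /altsum mulr_sumr -big_split /=.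
apply: eq_bigr => s _; rewrite mulrCA -mulrDr; congr (_ * _).
apply: (Fmul ((s^-1)%g i)); first by rewrite !row_row_perm permKV.
- by move=> j ji; rewrite !row_row_perm rB // (can2_eq (permK s) (permKV s)).
- by move=> j ji; rewrite !row_row_perm rC // (can2_eq (permK s) (permKV s)).
Qed.

Lemma multilinear_scale m (F : 'M[R]_(m, n) -> R) c :
  multilinear F -> multilinear (fun A => c * F A).
Proof.
by move=> Fmul i s A B C rA rB rC; rewrite (Fmul i s A B C) // mulrDr mulrCA.
Qed.

Lemma multilinear_add m (F G : 'M[R]_(m, n) -> R) :
  multilinear F -> multilinear G -> multilinear (fun A => F A + G A).
Proof.
move=> Fmul Gmul i s A B C rA rB rC; rewrite (Fmul i s A B C) // (Gmul i s A B C) //.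
by rewrite mulrDr addrACA.
Qed.

Lemma multilinear_wedge_at p q (a : 'M[R]_(p, n) -> R) (b : 'M[R]_(q, n) -> R) :
  multilinear a -> multilinear b -> multilinear (wedge_at a b).
Proof.
by move=> am bm; apply/multilinear_scale/multilinear_altsum/multilinear_tensor.
Qed.

Lemma multilinear_wedge_pow_at (w : 'M[R]_(2, n) -> R) r :
  multilinear w -> multilinear (wedge_pow_at w r).
Proof.
move=> wm; elim: r => [[]//|r IH].
exact: (@multilinear_wedge_at 2 (r * 2)).
Qed.

Definition setrow m (A : 'M[R]_(m, n)) (i : 'I_m) (v : 'rV[R]_n) : 'M[R]_(m, n) :=
  \matrix_(k, j) (if k == i then v 0 j else A k j).

Lemma row_setrow m (A : 'M[R]_(m, n)) i v k :
  row k (setrow A i v) = if k == i then v else row k A.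
Proof. by apply/rowP => j; rewrite !mxE; case: eqP; rewrite ?mxE. Qed.

Lemma setrow_id m (A : 'M[R]_(m, n)) i : setrow A i (row i A) = A.
Proof. by apply/row_matrixP => k; rewrite row_setrow; case: eqP => // ->. Qed.

Lemma multilinear_setrow m (F : 'M[R]_(m, n) -> R) A i s u v : multilinear F ->
  F (setrow A i (s *: u + v)) = s * F (setrow A i u) + F (setrow A i v).
Proof.
by move=> Fm; apply: (Fm i) => [|j|j]; rewrite !row_setrow ?eqxx // => /negPf ->.
Qed.

Lemma multilinear_setrowD m (F : 'M[R]_(m, n) -> R) A i u v : multilinear F ->
  F (setrow A i (u + v)) = F (setrow A i u) + F (setrow A i v).
Proof. by move=> Fm; rewrite -{1}[u]scale1r multilinear_setrow // mul1r. Qed.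

Lemma linear_law_sum (I : finType) (g : 'rV[R]_n -> R) (c : I -> R) (u : I -> 'rV[R]_n) :
  (forall s v v', g (s *: v + v') = s * g v + g v') ->
  g (\sum_i c i *: u i) = \sum_i c i * g (u i).
Proof.
move=> glin; have g0 : g 0 = 0.
  by have := glin (-1) 0 0; rewrite scaler0 add0r mulN1r addNr.
by apply: (big_rec2 (fun x y => g x = y)) => // i y x _ <-; rewrite glin.
Qed.

(** Expand F(.., x + y, .., x + y, ..) = 0 for a transposition, then decompose a
    permutation into transpositions. *)
Lemma multilinear_antisym m (F : 'M[R]_(m, n) -> R) :
  multilinear F -> alternating F -> antisym F.
Proof.
move=> Fm Fa.
have Ft i j A : i != j -> F (row_perm (tperm i j) A) = - F A.
  move=> ij; pose S x y := F (setrow (setrow A i x) j y).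
  have SD x y : S (x + y) (x + y) = S x x + S x y + (S y x + S y y).
    have comm u v : setrow (setrow A i u) j v = setrow (setrow A j v) i u.
      apply/row_matrixP => k; rewrite !row_setrow.
      by case: (k =P j) => // ->; rewrite eq_sym (negPf ij).
    rewrite /S multilinear_setrowD // !comm !multilinear_setrowD // -!comm.
    by rewrite addrACA.
  have S0 x : S x x = 0.
    by apply: (Fa i j _ ij); rewrite !row_setrow !eqxx (negPf ij).
  have := SD (row i A) (row j A); rewrite !S0 add0r addr0 => /eqP.
  rewrite eq_sym addr_eq0 => /eqP e.
  have -> : F (row_perm (tperm i j) A) = S (row j A) (row i A).
    congr F; apply/row_matrixP => k; rewrite row_row_perm !row_setrow.
    case: tpermP => [->|->|/eqP/negPf -> /eqP/negPf -> //]; first by rewrite (negPf ij) eqxx.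
    by rewrite eqxx.
  have -> : F A = S (row i A) (row j A).
    rewrite /S setrow_id; congr F; apply/row_matrixP => k; rewrite row_setrow.
    by case: eqP => // ->.
  by rewrite e opprK.
move=> s A; case: (prod_tpermP s) => ts -> {s}.
elim: ts A => [|[i j] ts IH] A /=.
  by rewrite big_nil row_perm1 odd_perm1 mul1r.
move=> /andP[/= ij dts]; rewrite big_cons row_permM /= Ft //.
by rewrite IH // odd_permM odd_tperm ij /= signrN mulNr.
Qed.

Definition kills m (F : 'M[R]_(m, n) -> R) (v : 'rV[R]_n) :=
  forall A i, row i A = v -> F A = 0.

Lemma kills_wedge_at p q (a : 'M[R]_(p, n) -> R) (b : 'M[R]_(q, n) -> R) v :
  kills a v -> kills b v -> kills (wedge_at a b) v.
Proof.
move=> av bv A i rA; rewrite /wedge_at altsum_eq0 ?mulr0 // => s.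
rewrite /tensor; case: (split_ordP ((s^-1)%g i)) => k ik.
  rewrite (av _ k) ?mul0r // -rA -[i](permKV s) ik.
  by apply/rowP => l; rewrite !mxE.
rewrite (bv _ k) ?mulr0 // -rA -[i](permKV s) ik.
by apply/rowP => l; rewrite !mxE.
Qed.

Lemma kills_wedge_pow_at (w : 'M[R]_(2, n) -> R) r v : kills w v -> kills (wedge_pow_at w r) v.
Proof.
move=> wv; elim: r => [A []//|r IH].
exact: (@kills_wedge_at 2 (r * 2)).
Qed.

(** F is induced by an alternating form on the quotient by the left kernel of N,
    whose dimension \rank N is smaller than m: the m arguments are dependent
    modulo that kernel. *)
Lemma alternating_eq0_of_rank m (F : 'M[R]_(m, n) -> R) k (N : 'M[R]_(n, k)) A :
  multilinear F -> alternating F -> (\rank N < m)%N ->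
  (forall v, v *m N = 0 -> kills F v) -> F A = 0.
Proof.
move=> Fm Fa rN killF.
have : kermx (A *m N) != 0.
  rewrite -mxrank_eq0 mxrank_ker -lt0n subn_gt0.
  exact: leq_ltn_trans (mxrankM_maxr _ _) rN.
case/rowV0Pn => u /sub_kermxP uAN u0.
have [i ui] : exists i, u 0 i != 0.
  apply/existsP; apply: contraNT u0 => /existsPn h.
  by apply/eqP/rowP => i; rewrite mxE; apply/eqP; have := h i; rewrite negbK.
suff : u 0 i * F A = 0 by move/eqP; rewrite mulf_eq0 (negPf ui) => /eqP.
transitivity (F (setrow A i (u *m A))); last first.
  by apply: (killF (u *m A) _ _ i); rewrite -?mulmxA // row_setrow eqxx.
have Flin s v v' : F (setrow A i (s *: v + v')) =
  s * F (setrow A i v) + F (setrow A i v') by exact: multilinear_setrow.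
rewrite mulmx_sum_row (linear_law_sum (u 0) (fun j => row j A) Flin).
rewrite (bigD1 i) //= setrow_id big1 ?addr0 // => j ji.
by rewrite (Fa i j) ?mulr0 // 1?eq_sym // !row_setrow eqxx (negPf ji).
Qed.

End Multilinear.

(** * Powers of a 2-form and the rank of its matrix *)

Section Pointwise.
Context {R : realType} {n : nat}.

Definition gram (w : 'M[R]_(2, n) -> R) : 'M[R]_n :=
  \matrix_(i, j) w (col_mx (delta_mx 0 i : 'rV[R]_n) (delta_mx 0 j : 'rV[R]_n)).

Definition covec (a : 'M[R]_(1, n) -> R) : 'cV[R]_n := \col_i a (delta_mx 0 i).

Lemma multilinear1P (a : 'M[R]_(1, n) -> R) s u v : multilinear a ->
  a (s *: u + v) = s * a u + a v.
Proof.
move=> am; apply: (am ord0) => [|j|j]; last 2 first.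
- by rewrite ord1.
- by rewrite ord1.
by apply/rowP => k; rewrite !mxE.
Qed.

Lemma covecE (a : 'M[R]_(1, n) -> R) v : multilinear a -> a v = (v *m covec a) 0 0.
Proof.
move=> am; rewrite {1}[v]row_sum_delta.
rewrite (linear_law_sum (v 0) (fun j => delta_mx 0 j)); last first.
  by move=> *; exact: multilinear1P.
by rewrite mxE; apply: eq_bigr => j _; rewrite mxE.
Qed.

Lemma gramE (w : 'M[R]_(2, n) -> R) (u v : 'rV[R]_n) : multilinear w ->
  w (col_mx u v) = (u *m gram w *m v^T) 0 0.
Proof.
move=> wm.
have l1 s (x y z : 'rV[R]_n) : w (col_mx (s *: x + y) z) = s * w (col_mx x z) + w (col_mx y z).
  apply: (wm (lshift 1 (ord0 : 'I_1)) s (col_mx (s *: x + y) z) (col_mx x z) (col_mx y z)).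
  - by rewrite !(rowKu (m1 := 1)); apply/rowP => k; rewrite !mxE.
  - by move=> j; case: (split_ordP (j : 'I_(1 + 1))) => k -> ; rewrite ?ord1 ?eqxx ?(rowKd (m1 := 1)).
  - by move=> j; case: (split_ordP (j : 'I_(1 + 1))) => k -> ; rewrite ?ord1 ?eqxx ?(rowKd (m1 := 1)).
have l2 s (x y z : 'rV[R]_n) : w (col_mx z (s *: x + y)) = s * w (col_mx z x) + w (col_mx z y).
  apply: (wm (rshift 1 (ord0 : 'I_1)) s (col_mx z (s *: x + y)) (col_mx z x) (col_mx z y)).
  - by rewrite !(rowKd (m1 := 1)); apply/rowP => k; rewrite !mxE.
  - by move=> j; case: (split_ordP (j : 'I_(1 + 1))) => k -> ; rewrite ?ord1 ?eqxx ?(rowKu (m1 := 1)).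
  - by move=> j; case: (split_ordP (j : 'I_(1 + 1))) => k -> ; rewrite ?ord1 ?eqxx ?(rowKu (m1 := 1)).
rewrite {1}[u]row_sum_delta (linear_law_sum (g := fun x : 'rV[R]_n => w (col_mx x v)) (u 0) (fun j => delta_mx 0 j)); last first.
  by move=> *; exact: l1.
rewrite -mulmxA mxE; apply: eq_bigr => i _; congr (_ * _).
rewrite {1}[v]row_sum_delta (linear_law_sum (g := fun x : 'rV[R]_n => w (col_mx (delta_mx 0 i : 'rV[R]_n) x)) (v 0) (fun j => delta_mx 0 j)); last first.
  by move=> *; exact: l2.
by rewrite mxE; apply: eq_bigr => j _; rewrite !mxE mulrC.
Qed.

Lemma trmx_gram (w : 'M[R]_(2, n) -> R) : antisym w -> (gram w)^T = - gram w.
Proof. by move=> wa; apply/matrixP => i j; rewrite !mxE antisym2. Qed.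

Lemma kills_ker_gram (w : 'M[R]_(2, n) -> R) v : multilinear w -> antisym w ->
  v *m gram w = 0 -> kills w v.
Proof.
move=> wm wa vw A i rA; rewrite [A]col_mx_nth_row.
have : (i = 0%N :> nat) \/ (i = 1%N :> nat) by have := ltn_ord i; lia.
case=> iv.
  have -> : nth_row A 0 = v by rewrite -rA -nth_rowE iv.
  by rewrite gramE // vw mul0mx mxE.
have -> : nth_row A 1 = v by rewrite -rA -nth_rowE iv.
by rewrite antisym2 // gramE // vw mul0mx mxE oppr0.
Qed.

Lemma ker_gramP (w : 'M[R]_(2, n) -> R) (v : 'rV[R]_n) : multilinear w ->
  v *m gram w = 0 <-> (forall u : 'rV[R]_n, w (col_mx v u) = 0).
Proof.
move=> wm; split=> [vw u|h]; first by rewrite gramE // vw mul0mx mxE.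
apply/rowP => j; rewrite [RHS]mxE; have := h (delta_mx 0 j).
by rewrite gramE // trmx_delta -colE [in LHS]mxE.
Qed.

Lemma delta_form m (S : 'M[R]_m) i j c :
  (delta_mx 0 i : 'rV[R]_m) *m S *m (c *: (delta_mx 0 j : 'rV[R]_m))^T = (c * S i j)%:M.
Proof.
rewrite linearZ /= trmx_delta -scalemxAr -rowE -colE.
by apply/matrixP => k l; rewrite !ord1 !mxE.
Qed.

(** Induction on r.  A Gram matrix which is not zero has a hyperbolic pair e, f;
    projecting the rows of W to the orthogonal of that pair lowers the rank by at
    most 2, and [wedge_pow_at_pair] brings e and f back.  Allowing the odd value 2r - 1 is what makes the rank of an alternating
    matrix even, in [rank_gram]. *)
Lemma wedge_pow_at_neq0 (w : 'M[R]_(2, n) -> R) r m (W : 'M[R]_(m, n)) :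
  multilinear w -> antisym w ->
  (r * 2 <= (\rank (W *m gram w *m W^T)).+1)%N ->
  exists C : 'M[R]_(r * 2, m), wedge_pow_at w r (C *m W) != 0.
Proof.
move=> wm wa; elim: r W => [|r IH] W rk; first by exists 0; exact: oner_neq0.
have form_tr k l (u : 'M[R]_(k, n)) (v : 'M[R]_(l, n)) :
    u *m gram w *m v^T = - (v *m gram w *m u^T)^T.
  by rewrite !trmx_mul trmxK trmx_gram // mulNmx mulmxN opprK mulmxA.
set S := W *m gram w *m W^T in rk.
have : S != 0 by rewrite -mxrank_eq0 -lt0n; lia.
case/matrix0Pn => i [j Sij].
pose x : 'rV[R]_m := delta_mx 0 i; pose y : 'rV[R]_m := (S i j)^-1 *: delta_mx 0 j.
pose e := x *m W; pose f := y *m W.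
have ef : e *m gram w *m f^T = 1%:M.
  transitivity (x *m S *m y^T); first by rewrite /e /f /S trmx_mul !mulmxA.
  by rewrite delta_form mulVf.
have fe : f *m gram w *m e^T = - 1%:M.
  by rewrite form_tr ef trmx1.
have self0 (v : 'rV[R]_n) : v *m gram w *m v^T = 0.
  have antisym0 (z : 'M[R]_1) : z = - z^T -> z = 0.
    move=> h; apply/matrixP => k l; rewrite !ord1 mxE.
    by have := congr1 (fun z' : 'M[R]_1 => z' 0 0) h; rewrite !mxE; lra.
  exact/antisym0/form_tr.
pose a := W *m gram w *m f^T; pose b := W *m gram w *m e^T.
have aT : a^T = - (f *m gram w *m W^T).
  by rewrite [in RHS]form_tr opprK.
have bT : b^T = - (e *m gram w *m W^T).
  by rewrite [in RHS]form_tr opprK.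
(* The rows of T *m W are those of W made orthogonal to e and f. *)
have [T TE] : exists T : 'M[R]_m, T = 1%:M - a *m x + b *m y by eexists.
have TW : T *m W = W - a *m e + b *m f.
  by rewrite TE !mulmxDl mulNmx mul1mx -!mulmxA.
have TWT : (T *m W)^T = W^T - e^T *m a^T + f^T *m b^T.
  by rewrite TW linearD linearB /= !trmx_mul.
have eT : e *m gram w *m (T *m W)^T = 0.
  rewrite TWT mulmxDr mulmxBr !mulmxA self0 ef mul0mx subr0 mul1mx bT.
  by rewrite addrN.
have fT : f *m gram w *m (T *m W)^T = 0.
  rewrite TWT mulmxDr mulmxBr !mulmxA self0 fe mul0mx addr0 mulNmx mul1mx aT.
  by rewrite opprK addrN.
have Tsym (v : 'rV[R]_n) : v *m gram w *m (T *m W)^T = 0 -> T *m W *m gram w *m v^T = 0.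
  by move=> h; rewrite form_tr h trmx0 oppr0.
(* S differs from the Gram matrix of T *m W by two matrices of rank at most 1. *)
have SE : S = T *m W *m gram w *m (T *m W)^T +
    (a *m (e *m gram w *m W^T) - b *m (f *m gram w *m W^T)).
  have WE : W = T *m W + (a *m e - b *m f).
    by rewrite TW addrACA subrK subrr addr0.
  rewrite {1}/S {1}WE !mulmxDl; congr (_ + _).
    have WT : W^T = (T *m W)^T + (e^T *m a^T - f^T *m b^T).
      by rewrite {1}WE linearD linearB /= !trmx_mul.
    by rewrite WT mulmxDr mulmxBr !mulmxA !Tsym // !mul0mx subr0 addr0.
  by rewrite !mulNmx !mulmxA.
have [|C CW] := IH (T *m W).
  have r1 k (c : 'cV[R]_k) l (d : 'rV[R]_l) : (\rank (c *m d) <= 1)%N.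
    exact: leq_trans (mxrankM_maxr _ _) (rank_leq_row _).
  move: rk; rewrite SE => rk.
  have := mxrank_add (T *m W *m gram w *m (T *m W)^T) (a *m (e *m gram w *m W^T) - b *m (f *m gram w *m W^T)).
  have := mxrank_add (a *m (e *m gram w *m W^T)) (- (b *m (f *m gram w *m W^T))).
  have := r1 _ a _ (e *m gram w *m W^T).
  have := r1 _ b _ (f *m gram w *m W^T).
  rewrite mxrank_opp; move: rk.
  by repeat match goal with |- context [mxrank ?X] => move: (mxrank X) => ? end; lia.
exists (col_mx x (col_mx y (C *m T)) : 'M[R]_(2 + r * 2, m)).
have orth v : v *m gram w *m (T *m W)^T = 0 -> orthog w v (C *m T *m W).
  move=> h k kr; rewrite (nth_rowE _ (Ordinal kr)) gramE // -(mulmxA C) row_mul trmx_mul.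
  by rewrite mulmxA h mul0mx mxE.
rewrite (_ : _ *m W = (col_mx e (col_mx f (C *m T *m W)) : 'M[R]_(2 + r * 2, n))); last first.
  exact: etrans (mul_col_mx x _ W) (congr1 (col_mx e) (mul_col_mx y _ W)).
rewrite wedge_pow_at_pair //; try exact: orth.
  by rewrite mulf_neq0 // ?pnatr_eq0 // -mulmxA.
by rewrite gramE // ef mxE.
Qed.

End Pointwise.

(** * The theorem in one tangent space *)

Section Class.
Context {R : realType} {n : nat}.

(** The bridge between the codimensions in the definition of the class, which are
    those of subspaces, and ranks of matrices. *)
Lemma dim_kernel k (N : 'M[R]_(n, k)) (K : {vspace 'rV[R]_n}) :
  (forall v, (v \in K) = (v *m N == 0)) -> (\dim K + \rank N)%N = n.
Proof.
move=> KP; pose B : 'M[R]_(\dim K, n) := \matrix_i (vbasis K)`_i.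
have BE u : u *m B = \sum_i u 0 i *: (vbasis K)`_i.
  by rewrite mulmx_sum_row; apply: eq_bigr => i _; rewrite rowK.
have Bfree : row_free B.
  rewrite -kermx_eq0; apply/rowV0P => u /sub_kermxP; rewrite BE => u0.
  have /freeP/(_ _ u0) h := basis_free (vbasisP K).
  by apply/rowP => i; rewrite h mxE.
have BN : (B == kermx N)%MS.
  apply/andP; split; apply/rV_subP => v.
    case/submxP => u ->; apply/sub_kermxP/eqP; rewrite -KP BE.
    by apply: memv_suml => i _; apply/memvZ/vbasis_mem/mem_nth; rewrite size_tuple.
  move/sub_kermxP/eqP; rewrite -KP => vK.
  apply/submxP; exists (\row_i vector.coord (vbasis K) i v).
  by rewrite BE {1}(coord_vbasis vK); apply: eq_bigr => i _; rewrite mxE.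
have : \rank B = \rank (kermx N) by rewrite (eqmxP BN).
rewrite (eqnP Bfree) mxrank_ker => ->.
by rewrite subnK // rank_leq_row.
Qed.

Lemma dim_fullv_rV : \dim {:'rV[R]_n} = n.
Proof. by rewrite dimvf /dim /= mul1n. Qed.

Lemma has_codim_kernel k (N : 'M[R]_(n, k)) c :
  has_codim [set v | v *m N = 0]%classic c -> \rank N = c.
Proof.
case=> K KE; rewrite dim_fullv_rV => dK.
have KP v : (v \in K) = (v *m N == 0).
  apply/idP/eqP => vK.
    have : [set v | v *m N = 0]%classic v by rewrite KE.
    by [].
  have : [set v | v \in K]%classic v by rewrite -KE.
  by [].
by apply: (@addnI (\dim K)); rewrite dK dim_kernel.
Qed.

Lemma col_mx_nil (v : 'rV[R]_n) (A : 'M[R]_(0, n)) : (col_mx v A : 'M[R]_(1, n)) = v.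
Proof. by apply: (@nth_rowP _ _ 1) => -[|//] k0; rewrite (@nth_row_col_mx _ _ 1 0). Qed.

Lemma Ker1E (t : 'M[R]_(1, n) -> R) v : Ker (k := 0) t v <-> t v = 0.
Proof.
rewrite /Ker /contract /=; split=> [/(_ 0)|h A]; first by rewrite col_mx_nil.
by rewrite col_mx_nil.
Qed.

Variables (t : 'M[R]_(1, n) -> R) (w : 'M[R]_(2, n) -> R).
Hypotheses (tm : multilinear t) (wm : multilinear w) (wa : antisym w).

(** The matrix of v |-> (i_v w, t v), so that the class of the pair is its rank. *)
Definition pairmx : 'M[R]_(n, n + 1) := row_mx (gram w) (covec t).

Lemma pairmxP v : v *m pairmx = 0 <-> v *m gram w = 0 /\ t v = 0.
Proof.
rewrite mul_mx_row (covecE _ tm) -[X in _ = X]row_mx0; split.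
  by move=> /eq_row_mx[-> ->]; rewrite mxE.
case=> -> tv; congr row_mx; apply/matrixP => i j; rewrite !ord1 tv.
by rewrite mxE.
Qed.

Lemma Ker_pairmx :
  (Ker (k := 0) t `&` Ker (k := 1) w = [set v | v *m pairmx = 0])%classic.
Proof.
apply/seteqP; split=> v /=.
  move=> [/Ker1E tv wv]; apply/pairmxP; split=> //.
  by apply/(ker_gramP _ wm) => u; exact: wv.
move/pairmxP => -[/(ker_gramP _ wm) wv tv]; split; first exact/Ker1E.
exact: wv.
Qed.

Variable r : nat.
Hypothesis class_tw : has_codim (Ker (k := 0) t `&` Ker (k := 1) w)%classic (2 * r + 1)%N.

Lemma rank_pairmx : \rank pairmx = (2 * r + 1)%N.
Proof. by move: class_tw; rewrite Ker_pairmx => /has_codim_kernel. Qed.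

(** The rank of w is 2r or 2r + 1, because t adds at most one equation.  If it
    were 2r + 1, then w^(r+1) would be nonzero by [wedge_pow_at_neq0] and zero by
    [alternating_eq0_of_rank]. *)
Lemma rank_gram : \rank (gram w) = (r * 2)%N.
Proof.
have rN := rank_pairmx.
have gle : (\rank (gram w) <= 2 * r + 1)%N.
  have -> : gram w = pairmx *m col_mx 1%:M 0.
    by rewrite mul_row_col mulmx1 mulmx0 addr0.
  by rewrite -rN; exact: mxrankM_maxl.
have gge : (2 * r <= \rank (gram w))%N.
  suff : (\rank pairmx <= \rank (gram w) + 1)%N by rewrite rN leq_add2r.
  have -> : pairmx = gram w *m row_mx 1%:M 0 + covec t *m row_mx 0 1%:M.
    by rewrite !mul_mx_row !mulmx1 !mulmx0 add_row_mx addr0 add0r.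
  apply: leq_trans (mxrank_add _ _) (leq_add (mxrankM_maxl _ _) _).
  exact: leq_trans (mxrankM_maxl _ _) (rank_leq_col _).
have [->|e] : \rank (gram w) = (r * 2)%N \/ \rank (gram w) = (2 * r + 1)%N by lia.
  by [].
have [|C] := @wedge_pow_at_neq0 R n w r.+1 n 1%:M wm wa.
  by rewrite mul1mx trmx1 mulmx1 e; lia.
rewrite (@alternating_eq0_of_rank _ _ _ _ _ (gram w)) ?eqxx //.
- exact: multilinear_wedge_pow_at.
- exact/antisym_alternating/wedge_pow_at_antisym.
- by rewrite e; lia.
- by move=> v vw; apply/kills_wedge_pow_at/kills_ker_gram.
Qed.

(** By [rank_gram] the kernel of w is strictly larger than its intersection with
    the kernel of t. *)
Lemma reeb_vector : exists X : 'rV[R]_n, X *m gram w = 0 /\ t X = 1.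
Proof.
have : ~~ (kermx (gram w) <= kermx pairmx)%MS.
  apply/negP => /mxrankS; rewrite !mxrank_ker rank_pairmx rank_gram.
  by have := rank_leq_row pairmx; rewrite rank_pairmx; lia.
case/row_subPn => i; set u := row i _ => up.
have uw : u *m gram w = 0 by apply/sub_kermxP/row_sub.
have tu : t u != 0 by apply: contraNneq up => tu; apply/sub_kermxP/pairmxP.
exists ((t u)^-1 *: u); rewrite -scalemxAl uw scaler0; split=> //.
by rewrite covecE // -scalemxAl mxE -covecE // mulVf.
Qed.

Variable a : 'M[R]_(1, n) -> R.
Hypothesis am : multilinear a.

Let Kzero := forall v, v *m gram w = 0 -> t v = 0 -> a v = 0.

(** If b vanishes on Ker w, then b /\ w^r lives on the quotient by Ker w, of
    dimension 2r < 2r + 1.  Conversely, for v in Ker w only b can receive v, so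
    that (b /\ w^r)(v, C) is a nonzero multiple of b(v) w^r(C), and w^r is not
    zero. *)
Lemma wedge_at_pow_eq0P (b : 'M[R]_(1, n) -> R) : multilinear b ->
  (forall A, wedge_at b (wedge_pow_at w r) A = 0) <-> (forall v, v *m gram w = 0 -> b v = 0).
Proof.
move=> bm; split=> [bw v vw|bw A]; last first.
  apply: (@alternating_eq0_of_rank _ _ _ _ _ (gram w)).
  - apply: multilinear_wedge_at => //; exact: multilinear_wedge_pow_at.
  - exact/antisym_alternating/wedge_at_antisym.
  - by rewrite rank_gram; lia.
  - move=> v vw; apply: kills_wedge_at; last exact/kills_wedge_pow_at/kills_ker_gram.
    move=> B i rB; have -> : B = v by rewrite -rB ord1; apply/rowP => j; rewrite !mxE.
    exact: bw.
have [|C Cw] := @wedge_pow_at_neq0 R n w r n 1%:M wm wa.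
  by rewrite mul1mx trmx1 mulmx1 rank_gram.
rewrite mulmx1 in Cw; have := bw (col_mx v C); rewrite /wedge_at altsum_col_mx.
rewrite big_ord_recl big1 => [|i _].
  rewrite addr0 expr0 mul1r (@eq_altsum _ _ _ _ (fun B => b v * wedge_pow_at w r B)) => [|s].
    rewrite altsumZ altsum_of_antisym; last exact: wedge_pow_at_antisym.
    move/eqP; rewrite mulrCA !mulf_eq0 invr_eq0 !mulf_eq0 (negPf Cw).
    by rewrite !pnatr_eq0 !(gtn_eqF (fact_gt0 _)) !orbF => /eqP.
  rewrite /tensor; congr (b _ * wedge_pow_at w r _); apply: nth_rowP => k kr.
    by rewrite nth_row_usubmx // nth_row_insert; case: k kr => [|[]//] _; rewrite nth_row_row.
  by rewrite nth_row_dsubmx nth_row_insert.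
rewrite altsum_eq0 ?mulr0 // => s; rewrite /tensor.
rewrite (@kills_wedge_pow_at _ _ w r v _ _ i) ?mulr0 //; first exact: kills_ker_gram.
by rewrite -nth_rowE nth_row_dsubmx nth_row_insert /= ltnn eqxx.
Qed.

Lemma wedge_at_subl (b c : 'M[R]_(1, n) -> R) q (g : 'M[R]_(q, n) -> R) s A :
  wedge_at (fun v => b v - s * c v) g A = wedge_at b g A - s * wedge_at c g A.
Proof.
rewrite /wedge_at mulrCA -mulrBr; congr (_ * _).
rewrite /altsum mulr_sumr -sumrB; apply: eq_bigr => x _.
rewrite /tensor; move: ((-1) ^+ x) (b _) (c _) (g _) => z u v y; ring.
Qed.

(** The equation says that (a - a(X) t) /\ w^r = 0, that is, a = a(X) t on Ker w.
    As Ker w is spanned by X and Ker t :&: Ker w, where the equality holds at X,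
    this is the vanishing of a on Ker t :&: Ker w. *)
Lemma pointwise_equation (X : 'rV[R]_n) : X *m gram w = 0 -> t X = 1 ->
  (forall A, a X * wedge_at t (wedge_pow_at w r) A = wedge_at a (wedge_pow_at w r) A) <-> Kzero.
Proof.
move=> Xw tX; pose b v := a v - a X * t v.
have bm : multilinear b.
  move=> i s A B C rA rB rC; rewrite /b -!mulNr.
  exact: (multilinear_add am (@multilinear_scale _ _ _ _ (- a X) tm) rA rB rC).
transitivity (forall A, wedge_at b (wedge_pow_at w r) A = 0).
  by split=> h A; have := h A; rewrite /b wedge_at_subl; [move=> ->; rewrite subrr|move/eqP; rewrite subr_eq0 => /eqP ->].
rewrite wedge_at_pow_eq0P //; split=> h v vw.
  by move=> tv; have := h v vw; rewrite /b tv mulr0 subr0.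
have := h (v - t v *: X); rewrite mulmxBl -scalemxAl vw Xw scaler0 subr0.
have tlin : t (v - t v *: X) = t v - t v * t X.
  by rewrite addrC -scaleNr multilinear1P // mulNr addrC.
have alin : a (v - t v *: X) = a v - t v * a X.
  by rewrite addrC -scaleNr multilinear1P // mulNr addrC.
rewrite tlin alin tX mulr1 subrr => /(_ erefl erefl); rewrite /b [_ * a X]mulrC.
by [].
Qed.

Lemma wedge_at11 (u v : 'rV[R]_n) :
  wedge_at a t (col_mx u v) = a u * t v - a v * t u.
Proof.
rewrite /wedge_at (@altsum_col_mx _ _ 1) !big_ord_recl big_ord0 addr0.
have e (i : 'I_(1 + 1)) :
    altsum (fun B => tensor a t (insert_row i u B)) v = tensor a t (insert_row i u v).
  rewrite /altsum (bigD1 1%g) //= big1 ?addr0 => [|s /eqP[]].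
    by rewrite row_perm1 odd_perm1 mul1r.
  by apply/permP => k; rewrite !ord1.
rewrite !e /= !mulr1 invr1 !mul1r expr1 mulN1r.
have hd (i : 'I_(1 + 1)) : usubmx (insert_row i u v) = nth_row (insert_row i u v) 0.
  by rewrite -nth_row_usubmx // nth_row_row.
have tl (i : 'I_(1 + 1)) : dsubmx (insert_row i u v) = nth_row (insert_row i u v) 1.
  by rewrite -[1%N]/(1 + 0)%N -nth_row_dsubmx nth_row_row.
by rewrite /tensor !hd !tl !nth_row_insert /= nth_row_row.
Qed.

(** The kernel of the new pair is that of the old one intersected with Ker a:
    for t v = 0 one has i_v (a /\ t + w) = a(v) t + i_v w, and evaluating this on
    a Reeb vector isolates a(v).  So the dimension of the kernel is preserved iff
    a vanishes on the old kernel. *)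
Lemma pointwise_class c : c != 0 ->
  has_codim (Ker (k := 0) (fun v => c * t v) `&`
    Ker (k := 1) (fun A => c * (wedge_at a t A + w A)))%classic (2 * r + 1) <-> Kzero.
Proof.
move=> c0; have [X [Xw tX]] := reeb_vector.
have wX (v : 'rV[R]_n) : w (col_mx v X) = 0.
  by rewrite antisym2 // (ker_gramP _ wm).1 // oppr0.
have KE : (Ker (k := 0) (fun v => c * t v) `&`
    Ker (k := 1) (fun A => c * (wedge_at a t A + w A)))%classic =
    [set v | [/\ v *m gram w = 0, t v = 0 & a v = 0]]%classic.
  apply/seteqP; split=> v /=.
    move=> [/Ker1E/eqP + h]; rewrite mulf_eq0 (negPf c0) => /eqP tv.
    have {}h (u : 'rV[R]_n) : a v * t u + w (col_mx v u) = 0.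
      have /eqP := h u; rewrite /contract mulf_eq0 (negPf c0) wedge_at11 tv mulr0 subr0.
      by move/eqP.
    have av : a v = 0 by have := h X; rewrite tX wX mulr1 addr0.
    split=> //; apply/(ker_gramP _ wm) => u.
    by have := h u; rewrite av mul0r add0r.
  move=> [/(ker_gramP _ wm) vw tv av]; split; first by apply/Ker1E; rewrite tv mulr0.
  by move=> u; rewrite /contract wedge_at11 tv av vw mulr0 mul0r subr0 addr0 mulr0.
have SE := Ker_pairmx.
rewrite KE; split.
  move=> [K' K'E dK'] v vw tv; case: class_tw => K; rewrite SE => KKE dK.
  have memK u : u \in K <-> u *m pairmx = 0 by move: (congr1 (fun S => S u) KKE) => /= ->; split.
  have memK' u : u \in K' <-> [/\ u *m gram w = 0, t u = 0 & a u = 0].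
    by move: (congr1 (fun S => S u) K'E) => /= ->; split.
  have sK : (K' <= K)%VS.
    by apply/subvP => u /memK'[uw tu _]; apply/memK/pairmxP.
  have /eqP eK : K' == K.
    by rewrite eqEdim sK -(leq_add2r (2 * r + 1)%N) dK dK' leqnn.
  by have /memK : v *m pairmx = 0 by [exact/pairmxP]; rewrite -eK => /memK'[].
move=> h; suff -> : [set v | [/\ v *m gram w = 0, t v = 0 & a v = 0]]%classic =
    (Ker (k := 0) t `&` Ker (k := 1) w)%classic by [].
rewrite SE; apply/seteqP; split=> v /=; first by move=> [vw tv _]; exact/pairmxP.
by move/pairmxP => [vw tv]; split=> //; exact: h.
Qed.

End Class.

Local Open Scope classical_set_scope.

(** * Continuous partial derivatives give differentiability *)

Lemma remainder_differentiable (R : realType) (V W : normedModType R) (f : V -> W)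
    (L : {linear V -> W}) y : continuous L ->
  (forall e : R, 0 < e -> \forall h \near 0, `|f (h + y) - f y - L h| <= e * `|h|) ->
  differentiable f y /\ 'd f y = L :> (V -> W).
Proof.
move=> Lc rem.
have Lo : f \o shift y = cst (f y) + L +o_ 0 id.
  apply/eqaddoP => e e0; apply: filterS (rem e e0) => h.
  by rewrite -[(_ - _) h]/(f (h + y) - (f y + L h)) opprD addrA.
have dE : 'd f y = L :> (V -> W) by exact: diff_unique.
by split=> //; apply/diff_locallyP; rewrite dE.
Qed.

Section Differentiability.
Context {R : realType} {n : nat}.
Implicit Types (f : 'rV[R]_n -> R) (v x y : 'rV[R]_n).

Lemma coord_norm_le v i : `|v 0 i| <= `|v|.
Proof. by rewrite [leRHS]/Num.Def.normr /= mx_normrE; exact: (le_bigmax _ _ (0, i)). Qed.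

Lemma norm_le_coord v c : 0 <= c -> (forall i, `|v 0 i| <= c) -> `|v| <= c.
Proof.
move=> c0 h; rewrite /Num.Def.normr /= mx_normrE (bigmax_le _ c0) //= => -[i j] _.
by rewrite ord1.
Qed.

Lemma is_derive_line (W : normedModType R) (f : 'rV[R]_n -> W) v x t : derivable f (t *: v + x) v ->
  is_derive t (1 : R) (fun s => f (s *: v + x)) ('D_v f (t *: v + x)).
Proof.
have E : (fun h : R => h^-1 *: (f ((h *: (1 : R) + t) *: v + x) - f (t *: v + x))) =
         (fun h : R => h^-1 *: (f (h *: v + (t *: v + x)) - f (t *: v + x))).
  by apply/funext => h; rewrite [h *: 1]mulr1 scalerDl addrA.
move=> df; apply: DeriveDef; first by rewrite /derivable /= E.
by rewrite /derive /= E.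
Qed.

Lemma mean_value_remainder (g dg : R -> R) s L e :
  (forall t, `|t| <= `|s| -> is_derive t (1 : R) g (dg t)) ->
  (forall t, `|t| <= `|s| -> `|dg t - L| <= e) ->
  `|g s - g 0 - s * L| <= e * `|s|.
Proof.
move=> gd dge.
have gc t : `|t| <= `|s| -> {for t, continuous g}.
  by move=> /gd [dt _]; exact/differentiable_continuous/derivable1_diffP.
have within (a b : R) : (forall t, t \in `[a, b]%R -> `|t| <= `|s|) ->
    {within `[a, b], continuous g}.
  move=> h; apply: derivable_within_continuous => t tab.
  by have [] := gd t (h _ tab).
suff [c cs ->] : exists2 c, `|c| <= `|s| & g s - g 0 = dg c * s.
  by rewrite [s * L]mulrC -mulrBl normrM ler_wpM2r // dge.
have [s0|s0] := leP 0 s.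
  have sub t : t \in `[0, s]%R -> `|t| <= `|s|.
    by rewrite in_itv /= => /andP[t0 ts]; rewrite !ger0_norm.
  have [|c cs] := @MVT_segment _ g dg 0 s s0 _ (within _ _ sub).
    by move=> t ts; apply/gd/sub; rewrite in_itv /= !ltW ?(itvP ts).
  by rewrite subr0; exists c => //; exact: sub.
have sub t : t \in `[s, 0]%R -> `|t| <= `|s|.
  by rewrite in_itv /= => /andP[st t0]; rewrite !ler0_norm ?lerN2 // ltW.
have [|c cs] := @MVT_segment _ g dg s 0 (ltW s0) _ (within _ _ sub).
  by move=> t ts; apply/gd/sub; rewrite in_itv /= !ltW ?(itvP ts).
rewrite sub0r mulrN => /eqP; rewrite -opprB eqr_opp => /eqP e1.
by exists c => //; exact: sub.
Qed.

Definition lincomb (c : 'I_n -> R) v : R := \sum_i v 0 i * c i.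

Lemma lincomb_is_linear c : linear (lincomb c).
Proof.
move=> s u v; rewrite /lincomb scaler_sumr -big_split; apply: eq_bigr => i _ /=.
by rewrite !mxE mulrDl -mulrA.
Qed.

HB.instance Definition _ c := GRing.isLinear.Build R 'rV[R]_n R _ (lincomb c)
  (lincomb_is_linear c).

Lemma lincomb_continuous c : continuous (lincomb c).
Proof.
apply: (continuous_big add_continuous) => i _ v.
have h := @coord_continuous R 1 n 0 i v.
exact (cvgMr_tmp h).
Qed.

Definition take_coords (k : nat) v : 'rV[R]_n := \row_i (if (i < k)%N then v 0 i else 0).

(** Move from y to v + y along one coordinate at a time and apply the mean value
    theorem to each step. *)
Lemma C1_remainder f y e d v : 0 <= e ->
  (forall z (i : 'I_n), `|z - y| < d -> derivable f z (delta_mx 0 i)) ->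
  (forall z (i : 'I_n), `|z - y| < d -> `|'D_(delta_mx 0 i) f z - 'D_(delta_mx 0 i) f y| <= e) ->
  `|v| < d ->
  `|f (v + y) - f y - lincomb (fun i => 'D_(delta_mx 0 i) f y) v| <= e * n%:R * `|v|.
Proof.
move=> e0 fd fe vd.
suff H k : (k <= n)%N ->
  `|f (take_coords k v + y) - f y - \sum_(i < n | (i < k)%N) v 0 i * 'D_(delta_mx 0 i) f y|
    <= e * k%:R * `|v|.
  have tv : take_coords n v = v by apply/rowP => i; rewrite mxE ltn_ord.
  have := H n (leqnn n); rewrite tv /lincomb; congr (`|_ - _| <= _).
  by apply: eq_bigl => i; rewrite ltn_ord.
elim: k => [|k IH] kn.
  have -> : take_coords 0 v = 0 by apply/rowP => i; rewrite !mxE.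
  by rewrite add0r subrr big1 ?subr0 ?normr0 ?mulr0 ?mul0r.
pose i := Ordinal kn; pose g t := f (t *: delta_mx 0 i + (take_coords k v + y)).
have S : take_coords k.+1 v = v 0 i *: delta_mx 0 i + take_coords k v.
  apply/rowP => j; rewrite !mxE eqxx ltnS leq_eqVlt /= -(inj_eq val_inj) /=.
  case: eqP => [jk|_] /=; last by rewrite mulr0 add0r.
  by rewrite jk ltnn mulr1 addr0; congr (v 0 _); apply/val_inj.
have near_y t : `|t| <= `|v 0 i| -> `|t *: delta_mx 0 i + (take_coords k v + y) - y| < d.
  move=> ti; apply: le_lt_trans vd; rewrite addrA addrK.
  apply: norm_le_coord => // j; rewrite !mxE eqxx -(inj_eq val_inj) /=.
  case: (ltngtP j k) => jk; rewrite ?mulr0 ?add0r ?mulr1 ?addr0 ?coord_norm_le ?normr0 //.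
  exact: le_trans ti (coord_norm_le _ _).
have := @mean_value_remainder g (fun t => 'D_(delta_mx 0 i) f (t *: delta_mx 0 i + (take_coords k v + y)))
  (v 0 i) ('D_(delta_mx 0 i) f y) e.
move=> /(_ (fun t ts => is_derive_line (fd _ i (near_y t ts))))
  /(_ (fun t ts => fe _ i (near_y t ts))) step.
have -> : f (take_coords k.+1 v + y) = g (v 0 i) by rewrite /g S addrA.
have g0 : g 0 = f (take_coords k v + y) by rewrite /g scale0r add0r.
rewrite (bigD1 i) //= (eq_bigl (fun j : 'I_n => (j < k)%N)); last first.
  move=> j; rewrite -(inj_eq val_inj) /= ltnS leq_eqVlt.
  by case: ltngtP.
set c := 'D_ _ f y in step *; set s := \sum_(j < n | _) _ in IH *.
have -> : g (v 0 i) - f y - (v 0 i * c + s) =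
    (g (v 0 i) - g 0 - v 0 i * c) + (g 0 - f y - s) by ring.
apply: le_trans (ler_normD _ _) _.
rewrite g0 in step *; rewrite -[k.+1]addn1 natrD mulrDr mulr1 mulrDl addrC lerD ?IH 1?ltnW //.
by apply: le_trans step _; rewrite ler_wpM2l // coord_norm_le.
Qed.

(** Smoothness is defined by iterated partial derivatives, whereas the chain rule
    and the differentials in the definitions of [differential] and [change] need
    Frechet differentiability. *)
Lemma C1_differentiable f y d : 0 < d ->
  (forall z (i : 'I_n), `|z - y| < d -> derivable f z (delta_mx 0 i)) ->
  (forall i : 'I_n, {for y, continuous ('D_(delta_mx 0 i) f)}) ->
  differentiable f y /\ forall v, 'd f y v = lincomb (fun i => 'D_(delta_mx 0 i) f y) v.
Proof.
move=> d0 fd fc; pose L : {linear 'rV[R]_n -> R} := lincomb (fun i => 'D_(delta_mx 0 i) f y).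
suff rem (e : R) : 0 < e -> \forall h \near (0 : 'rV[R]_n), `|f (h + y) - f y - L h| <= e * `|h|.
  have [df dE] := @remainder_differentiable R 'rV[R]_n R f L y (@lincomb_continuous _) rem.
  by split=> // v; rewrite dE.
move=> e0; pose e' := e / n.+1%:R.
have e'0 : 0 < e' by rewrite divr_gt0 // ltr0n.
have : \forall z \near y, forall i : 'I_n, `|'D_(delta_mx 0 i) f z - 'D_(delta_mx 0 i) f y| <= e'.
  apply: (@filter_forall _ _ (fun (i : 'I_n) z => `|'D_(delta_mx 0 i) f z - 'D_(delta_mx 0 i) f y| <= e') (nbhs y)) => i; have /cvgrPdist_le/(_ _ e'0) := fc i.
  by apply: filterS => z; rewrite distrC.
move=> /nbhs_ballP[d1 /= d10 hd1].
apply/nbhs_ballP; exists (Num.min d d1) => /=; first by rewrite lt_min d0.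
move=> v; rewrite -ball_normE /= sub0r normrN lt_min => /andP[vd vd1].
have h := @C1_remainder f y e' (Num.min d d1) v (ltW e'0).
apply: le_trans (h _ _ _) _.
- by move=> z i; rewrite lt_min => /andP[zd _]; exact: fd.
- move=> z i; rewrite lt_min => /andP[_ zd]; apply: hd1.
  by rewrite -ball_normE /= distrC.
- by rewrite lt_min vd.
- rewrite ler_wpM2r // /e' -mulrA ler_piMr ?ltW //.
  by rewrite mulrC ltr_pdivrMr ?ltr0n // mul1r ltr_nat.
Qed.

End Differentiability.

(** * Closure properties of smooth functions *)

Section CkGeneral.
Context {R : realType} {n : nat} {W : normedModType R}.
Implicit Types (U V : set 'rV[R]_n) (f g : 'rV[R]_n -> W).

Lemma Ck_continuous k U f y : Ck k U f -> U y -> {for y, continuous f}.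
Proof. by case: k => [|k] [fc _]; exact: fc. Qed.

Lemma Ck_derivable k U f y i : Ck k.+1 U f -> U y -> derivable f y (delta_mx 0 i).
Proof. by move=> [_ /(_ i)[fd _]]; exact: fd. Qed.

Lemma Ck_derive k U f (i : 'I_n) : Ck k.+1 U f -> Ck k U ('D_(delta_mx 0 i) f).
Proof. by move=> [_ /(_ i)[_ fd]]. Qed.

Lemma Ck_pred k U f : Ck k.+1 U f -> Ck k U f.
Proof.
elim: k f => [|k IH] f [fc fd]; split=> // i; split; first by case: (fd i).
by apply: IH; case: (fd i).
Qed.

Lemma Ck_sub k U V f : V `<=` U -> Ck k U f -> Ck k V f.
Proof.
move=> VU; elim: k f => [|k IH] f [fc fd]; split=> //; do ?[by move=> y /VU; exact: fc].
move=> i; have [fdi fdk] := fd i; split; first by move=> y /VU; exact: fdi.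
exact: IH.
Qed.

Lemma Ck_eq k U f g : open U -> (forall y, U y -> f y = g y) -> Ck k U f -> Ck k U g.
Proof.
move=> Uo; have nfg f' g' (h : forall y, U y -> f' y = g' y) y : U y -> \near y, f' y = g' y.
  by move=> Uy; apply: filterS h _; exact: open_nbhs_nbhs.
have ceq f' g' y : (forall y, U y -> f' y = g' y) -> U y ->
    {for y, continuous f'} -> {for y, continuous g'}.
  move=> h Uy; rewrite /prop_for /continuous_at -(h y Uy) => c.
  exact: cvg_trans (near_eq_cvg (nfg _ _ h y Uy)) c.
elim: k f g => [|k IH] f g fg [fc fd]; split=> //; do ?[
  by move=> y Uy; exact: ceq fg Uy (fc y Uy)].
move=> i; have [fdi fdk] := fd i; split.
  by move=> y Uy; apply: near_eq_derivable (nfg _ _ fg y Uy) (fdi y Uy).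
by apply: IH fdk => y Uy; apply: near_eq_derive; exact: nfg.
Qed.

(** The iterated derivatives of f do not depend on the set, so being C^k on a
    set is a property of its points. *)
Lemma Ck_cover k U f : (forall y, U y -> exists2 V, V y & Ck k V f) -> Ck k U f.
Proof.
elim: k f => [|k IH] f loc; split=> //; do ?[
  by move=> y /loc[V Vy fV]; exact: Ck_continuous fV Vy].
move=> i; split; first by move=> y /loc[V Vy fV]; exact: Ck_derivable fV Vy.
apply: IH => y /loc[V Vy fV]; exists V => //; exact: Ck_derive.
Qed.

Lemma smooth_on_cover U f : (forall y, U y -> exists V g,
    [/\ open V, V y, forall z, V z -> f z = g z & smooth_on V g]) -> smooth_on U f.
Proof.
move=> loc k; apply: Ck_cover => y /loc[V [g [Vo Vy fg gs]]].
by exists V => //; apply: Ck_eq (gs k) => // z Vz; rewrite fg.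
Qed.

Lemma Ck_cst k U (c : W) : Ck k U (cst c).
Proof.
elim: k c => [|k IH] c; split=> //; try by move=> y _; exact: (@cst_continuous 'rV[R]_n W c y).
move=> i; split; first by move=> y _; exact: derivable_cst.
rewrite (_ : 'D__ _ = cst 0); first exact: IH.
by apply/funext => y; exact: derive_cst.
Qed.

End CkGeneral.

Section CkReal.
Context {R : realType} {n : nat}.
Implicit Types (U : set 'rV[R]_n) (f g : 'rV[R]_n -> R).

Lemma Ck_add k U f g : open U -> Ck k U f -> Ck k U g -> Ck k U (fun y => f y + g y).
Proof.
move=> Uo; elim: k f g => [|k IH] f g fk gk; split=> //; do ?[
  by move=> y Uy; exact: cvgD (Ck_continuous fk Uy) (Ck_continuous gk Uy)].
move=> i; have fd y (Uy : U y) := Ck_derivable (i := i) fk Uy.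
have gd y (Uy : U y) := Ck_derivable (i := i) gk Uy; split.
  by move=> y Uy; exact: derivableD (fd y Uy) (gd y Uy).
apply: (@Ck_eq _ _ _ _ _ (fun y => 'D_(delta_mx 0 i) f y + 'D_(delta_mx 0 i) g y)) => //.
  by move=> y Uy; rewrite -deriveD //; [exact: fd|exact: gd].
by apply: IH; exact: Ck_derive.
Qed.

Lemma Ck_mul k U f g : open U -> Ck k U f -> Ck k U g -> Ck k U (fun y => f y * g y).
Proof.
move=> Uo; elim: k f g => [|k IH] f g fk gk; split=> //; do ?[
  by move=> y Uy; exact: cvgM (Ck_continuous fk Uy) (Ck_continuous gk Uy)].
move=> i; have fd y (Uy : U y) := Ck_derivable (i := i) fk Uy.
have gd y (Uy : U y) := Ck_derivable (i := i) gk Uy; split.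
  by move=> y Uy; exact: derivableM (fd y Uy) (gd y Uy).
apply: (@Ck_eq _ _ _ _ _ (fun y => f y * 'D_(delta_mx 0 i) g y + g y * 'D_(delta_mx 0 i) f y)) => //.
  by move=> y Uy; exact: esym (deriveM (fd y Uy) (gd y Uy)).
by apply: Ck_add => //; apply: IH; (exact: Ck_derive || exact: Ck_pred).
Qed.

Lemma smooth_on_cst U (c : R) : smooth_on U (cst c).
Proof. by move=> k; exact: Ck_cst. Qed.

Lemma smooth_on_add U f g : open U -> smooth_on U f -> smooth_on U g ->
  smooth_on U (fun y => f y + g y).
Proof. by move=> Uo fs gs k; exact: Ck_add. Qed.

Lemma smooth_on_mul U f g : open U -> smooth_on U f -> smooth_on U g ->
  smooth_on U (fun y => f y * g y).
Proof. by move=> Uo fs gs k; exact: Ck_mul. Qed.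

Lemma smooth_on_sum U (I : Type) (r : seq I) (P : pred I) (F : I -> 'rV[R]_n -> R) :
  open U -> (forall i, P i -> smooth_on U (F i)) ->
  smooth_on U (fun y => \sum_(i <- r | P i) F i y).
Proof.
move=> Uo Fs; elim: r => [|i r IH].
  by rewrite (_ : (fun _ => _) = cst 0); [exact: smooth_on_cst|apply/funext => y; rewrite big_nil].
have [Pi|Pi] := boolP (P i).
  rewrite (_ : (fun _ => _) = (fun y => F i y + \sum_(j <- r | P j) F j y)).
    by apply: smooth_on_add => //; exact: Fs.
  by apply/funext => y; rewrite big_cons Pi.
by under eq_fun do rewrite big_cons (negPf Pi).
Qed.

Lemma smooth_on_prod U (I : Type) (r : seq I) (P : pred I) (F : I -> 'rV[R]_n -> R) :
  open U -> (forall i, P i -> smooth_on U (F i)) ->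
  smooth_on U (fun y => \prod_(i <- r | P i) F i y).
Proof.
move=> Uo Fs; elim: r => [|i r IH].
  by rewrite (_ : (fun _ => _) = cst 1); [exact: smooth_on_cst|apply/funext => y; rewrite big_nil].
have [Pi|Pi] := boolP (P i).
  rewrite (_ : (fun _ => _) = (fun y => F i y * \prod_(j <- r | P j) F j y)).
    by apply: smooth_on_mul => //; exact: Fs.
  by apply/funext => y; rewrite big_cons Pi.
by under eq_fun do rewrite big_cons (negPf Pi).
Qed.

Lemma derive_coord (i j : 'I_n) y :
  is_derive y (delta_mx 0 j : 'rV[R]_n) (fun z : 'rV[R]_n => z 0 i) ((delta_mx 0 j : 'rV[R]_n) 0 i).
Proof.
have d : differentiable (fun z : 'rV[R]_n => z 0 i) y by exact: differentiable_coord.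
apply: DeriveDef; first exact: diff_derivable.
pose c := (delta_mx 0 j : 'rV[R]_n) 0 i.
have E : \forall h \near (0 : R)^', cst c h =
    h^-1 *: ((h *: (delta_mx 0 j : 'rV[R]_n) + y) 0 i - y 0 i).
  near=> h; rewrite [X in X - _]mxE addrK [X in _ *: X]mxE /GRing.scale /= mulKf //.
  by near: h; exact: nbhs_dnbhs_neq.
by apply: cvg_lim => //; exact: cvg_trans (near_eq_cvg E) (cvg_cst c).
Unshelve. all: by end_near. Qed.

Lemma smooth_on_coord U i : smooth_on U (fun y : 'rV[R]_n => y 0 i).
Proof.
case=> [|k]; split=> //; do ?by move=> y _; exact: coord_continuous.
move=> j; split; first by move=> y _; have [] := derive_coord i j y.
rewrite (_ : 'D__ _ = cst ((delta_mx 0 j : 'rV[R]_n) 0 i)); first exact: Ck_cst.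
by apply/funext => y; have [_ ->] := derive_coord i j y.
Qed.

End CkReal.

(** * Composition with functions of one variable *)

Section Composition.
Context {R : realType} {n : nat}.

(** Only the derivative of phi along the line through y is needed, which lets the
    chain rule start from partial derivatives of phi. *)
Lemma is_derive_comp_line (V W : normedModType R) (phi : 'rV[R]_n -> V) (g : V -> W) y v :
  derivable phi y v -> differentiable g (phi y) ->
  is_derive y v (g \o phi) ('d g (phi y) ('D_v phi y)).
Proof.
move=> dphi dg; pose c (t : R) := phi (t *: v + y).
have c0 : c 0 = phi y by rewrite /c scale0r add0r.
have lineE (X : normedModType R) (f : 'rV[R]_n -> X) :
    (fun h : R => h^-1 *: (f (h *: v + y) - f y)) =
    (fun h : R => h^-1 *: ((fun t => f (t *: v + y)) (h *: (1 : R) + 0) - (fun t => f (t *: v + y)) 0)).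
  by apply/funext => h; rewrite addr0 scale0r add0r [h *: 1]mulr1.
have dc : derivable c 0 1 by rewrite /derivable /= -lineE.
have dcE : 'D_1 c 0 = 'D_v phi y by rewrite /derive /= -lineE.
have dc' : differentiable c 0 by exact/derivable1_diffP.
have dgc : differentiable (g \o c) 0 by apply: differentiable_comp; rewrite ?c0.
apply: DeriveDef.
  rewrite /derivable /= (lineE W (g \o phi)).
  exact: (derivable1_diffP (g \o c) 0).2.
rewrite /derive /= (lineE W (g \o phi)) -/('D_1 (g \o c) 0) deriveE // diff_comp ?c0 //=.
by rewrite -(deriveE (1 : R) dc') dcE.
Qed.

(** A class P of functions of one variable which is closed under derivation on D
    consists of functions that are smooth on D.  This form avoids writing down the
    successive derivatives. *)
Lemma Ck_comp1 (D : set R) (P : (R -> R) -> Prop) :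
  (forall G, P G -> exists2 G', P G' & forall t, D t -> is_derive t (1 : R) G (G' t)) ->
  forall k (U : set 'rV[R]_n) G f, open U -> (forall y, U y -> D (f y)) ->
  P G -> Ck k U f -> Ck k U (fun y => G (f y)).
Proof.
move=> Pd k U G f Uo fD; elim: k G => [|k IH] G PG fk; have [G' PG' dG] := Pd G PG.
  split=> // y Uy; apply: continuous_comp; first exact: Ck_continuous fk Uy.
  by apply/differentiable_continuous/derivable1_diffP; have [] := dG _ (fD y Uy).
have GD y (Uy : U y) i : is_derive y (delta_mx 0 i) (fun y => G (f y))
    ('D_(delta_mx 0 i) f y * G' (f y)).
  have [dGy GyE] := dG _ (fD y Uy).
  have dGd : differentiable G (f y) by exact/derivable1_diffP.
  have := is_derive_comp_line (Ck_derivable (i := i) fk Uy) dGd.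
  have lin u : 'd G (f y) u = u * 'd G (f y) 1.
    by rewrite -[in LHS](mulr1 u) -[u * 1]/(u *: (1 : R)) linearZ.
  by rewrite lin -GyE (deriveE (1 : R) dGd).
split.
  move=> y Uy; apply: continuous_comp; first exact: Ck_continuous fk Uy.
  by apply/differentiable_continuous/derivable1_diffP; have [] := dG _ (fD y Uy).
move=> i; split; first by move=> y Uy; have [] := GD y Uy i.
apply: (@Ck_eq _ _ _ _ _ (fun y => 'D_(delta_mx 0 i) f y * G' (f y))) => //.
  by move=> y Uy; have [_ ->] := GD y Uy i.
by apply: Ck_mul => //; [exact: Ck_derive|apply: IH => //; exact: Ck_pred].
Qed.

Lemma smooth_on_expR (U : set 'rV[R]_n) f : open U -> smooth_on U f ->
  smooth_on U (fun y => expR (f y)).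
Proof.
move=> Uo fs k; apply: (@Ck_comp1 setT (fun G => G = @expR R)) => //.
by move=> _ ->; exists (@expR R) => // t _; exact: is_derive_expR.
Qed.

Lemma is_derive_horner_inv (p : {poly R}) (t : R) : t != 0 ->
  is_derive t (1 : R) (fun s => p.[s^-1]) ((- ('X^2 * p^`())).[t^-1]).
Proof.
move=> t0.
have dV : is_derive t (1 : R) (fun s : R => s^-1) (- t ^- 2).
  have := @deriveV _ _ (fun s : R => s) t 1 t0 (@derivable_id R R t 1).
  rewrite derive_id => e; apply: DeriveDef; last by rewrite e /GRing.scale /= mulr1.
  exact: derivableV.
have dp := is_derive_poly p t^-1.
have := @is_derive1_comp R (horner p) (fun s => s^-1) t _ _ dp dV.
move=> [h1 h2]; apply: DeriveDef => //; rewrite h2.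
by rewrite hornerN hornerM hornerXn exprVn mulrN mulrC.
Qed.

(** The polynomials in 1 / s are closed under derivation. *)
Lemma smooth_on_inv (U : set 'rV[R]_n) (f : 'rV[R]_n -> R) : open U -> (forall y, U y -> f y != 0) ->
  smooth_on U f -> smooth_on U (fun y => (f y)^-1).
Proof.
move=> Uo f0 fs k.
pose P (G : R -> R) := exists p : {poly R}, G = fun s => p.[s^-1].
apply: (@Ck_comp1 [set t | t != 0] P _ k U (fun s => s^-1) f) => //.
  move=> _ [p ->]; exists (fun s => (- ('X^2 * p^`())).[s^-1]).
    by exists (- ('X^2 * p^`())).
  by move=> t t0; exact: is_derive_horner_inv.
by exists 'X; apply/funext => s; rewrite hornerX.
Qed.

(** For p = 1 this is the function exp(-1/t) extended by 0; the polynomial factor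
    closes the family under derivation. *)
Definition flat (p : {poly R}) (t : R) : R :=
  if 0 < t then p.[t^-1] * expR (- t^-1) else 0.

(** exp(t) dominates t^(m+1) / (m+1)! for m = size p. *)
Lemma horner_expR_le (p : {poly R}) : exists2 C, 0 <= C &
  forall t, 1 <= t -> `|p.[t] * expR (- t)| <= C / t.
Proof.
pose m := size p; pose S := \sum_(i < m) `|p`_i|.
exists (S * m.+1`!%:R); first by rewrite mulr_ge0 // sumr_ge0.
move=> t t1; have t0 : 0 < t by exact: lt_le_trans ltr01 t1.
have pS : `|p.[t]| <= S * t ^+ m.
  rewrite horner_coef mulr_suml; apply: le_trans (ler_norm_sum _ _ _) _.
  apply: ler_sum => i _; rewrite normrM ler_wpM2l // ger0_norm; last by rewrite exprn_ge0 // ltW.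
  by apply: ler_weXn2l => //; exact: ltnW.
have eS : expR (- t) <= m.+1`!%:R / t ^+ m.+1.
  have f0 : 0 < m.+1`!%:R :> R by rewrite ltr0n fact_gt0.
  rewrite expRN -[leRHS]invrK lef_pV2 ?posrE ?expR_gt0 //; last first.
    by rewrite invr_gt0 divr_gt0 // exprn_gt0.
  rewrite invfM invrK mulrC; apply: le_trans (expR_ge1Dxn m (ltW t0)).
  by rewrite lerDr.
rewrite normrM [`|expR _|]ger0_norm ?expR_ge0 //.
apply: le_trans (ler_pM (normr_ge0 _) (expR_ge0 _) pS eS) _.
rewrite le_eqVlt; apply/orP; left; apply/eqP.
by rewrite exprS; field; rewrite expf_neq0 ?lt0r_neq0.
Qed.

Lemma flat_cvg0 (p : {poly R}) : flat p t @[t --> (0 : R)^'] --> (0 : R).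
Proof.
have [C C0 pC] := horner_expR_le p.
have C1 : 0 < C + 1 by rewrite ltr_wpDl.
apply/cvgrPdist_le => e e0; near=> t.
rewrite sub0r normrN /flat; case: ifPn => [t0|_]; last by rewrite normr0 ltW.
have t1 : 1 <= t^-1.
  rewrite invf_ge1 //; apply: le_trans (ler_norm _) _.
  by near: t; apply: dnbhs0_le.
apply: le_trans (pC _ t1) _; rewrite invrK.
apply: (@le_trans _ _ ((C + 1) * `|t|)).
  by rewrite (ger0_norm (ltW t0)) ler_wpM2r ?(ltW t0) // lerDl.
rewrite mulrC -ler_pdivlMr //; near: t; apply: dnbhs0_le.
by rewrite divr_gt0.
Unshelve. all: by end_near. Qed.

(** At 0 the difference quotient is [flat] of 'X * p, which tends to 0. *)
Lemma is_derive_flat (p : {poly R}) (t : R) :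
  is_derive t (1 : R) (flat p) (flat ('X^2 * (p - p^`())) t).
Proof.
have [t0|t0|<-] := ltgtP 0 t.
- have dh := is_derive_horner_inv p (lt0r_neq0 t0).
  have dX : is_derive t (1 : R) (fun s => - s^-1) (t^-1 ^+ 2).
    have := is_derive_horner_inv (- 'X) (lt0r_neq0 t0).
    rewrite derivN derivX mulrN opprK mulr1 hornerXn.
    by rewrite (_ : (fun s => _) = (fun s => - s^-1)) //; apply/funext => s; rewrite hornerN hornerX.
  have de := @is_derive1_comp R (@expR R) (fun s => - s^-1) t _ _ (is_derive_expR _) dX.
  have := is_deriveM dh de.
  rewrite /flat t0 => d; apply: near_eq_is_derive (is_derive_eq d _).
    near=> s; rewrite ifT //; near: s; exact: lt_nbhsr.
  rewrite /GRing.scale /= !hornerE.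
  have gen (a b c u : R) : a * c * u * u + c * - (u ^+ 2 * b) = u ^+ 2 * (a - b) * c by ring.
  exact: gen.
- rewrite /flat ltNge (ltW t0) /=.
  apply: near_eq_is_derive (is_derive_cst (0 : R) t 1).
  near=> s; rewrite ifF //; apply/negbTE; rewrite -leNgt ltW //; near: s.
  exact: lt_nbhsl.
- have p0 q : flat q 0 = 0 by rewrite /flat ltxx.
  have c : h^-1 *: (flat p (h *: (1 : R) + 0) - flat p 0) @[h --> (0 : R)^'] --> (0 : R).
    rewrite (_ : (fun h => _) = flat ('X * p)); first exact: flat_cvg0.
    apply/funext => h; rewrite addr0 [h *: 1]mulr1 p0 subr0 /flat.
    by case: ifP => _; rewrite ?scaler0 // hornerM hornerX -mulrA.
  rewrite p0; apply: DeriveDef; first by apply/cvg_ex; exists 0.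
  exact/cvg_lim.
Unshelve. all: by end_near. Qed.

Lemma smooth_on_flat (U : set 'rV[R]_n) (f : 'rV[R]_n -> R) : open U ->
  smooth_on U f -> smooth_on U (fun y => flat 1 (f y)).
Proof.
move=> Uo fs k; apply: (@Ck_comp1 setT (fun G => exists p, G = flat p)) => //.
  move=> _ [p ->]; exists (flat ('X^2 * (p - p^`()))); first by exists ('X^2 * (p - p^`())).
  by move=> t _; exact: is_derive_flat.
by exists 1.
Qed.

Lemma flat_gt0 t : 0 < t -> 0 < flat 1 t.
Proof. by move=> t0; rewrite /flat t0 hornerC mul1r expR_gt0. Qed.

Lemma flat_le0 t : t <= 0 -> flat 1 t = 0.
Proof. by move=> t0; rewrite /flat ltNge t0. Qed.

Lemma flat_ge0 t : 0 <= flat 1 t.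
Proof. by have [/flat_le0->//|/flat_gt0/ltW] := leP t 0. Qed.

End Composition.

(** * Vector-valued functions and the chain rule *)

Section Rows.
Context {R : realType} {n : nat}.

Lemma continuous_row m (f : 'rV[R]_n -> 'rV[R]_m) y :
  (forall j, {for y, continuous (fun z => f z 0 j)}) -> {for y, continuous f}.
Proof.
move=> fc; apply: (cvgrPdist_le (F := nbhs y) f (f y)).2 => e e0.
have : \forall z \near y, forall j, `|f y 0 j - f z 0 j| <= e.
  apply: (@filter_forall _ _ (fun (j : 'I_m) z => `|f y 0 j - f z 0 j| <= e) (nbhs y)) => j.
  by have /cvgrPdist_le/(_ _ e0) := fc j.
apply: filterS => z h; apply: norm_le_coord; first exact: ltW.
by move=> j; rewrite !mxE.
Qed.

Lemma continuous_entry m (f : 'rV[R]_n -> 'rV[R]_m) y j :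
  {for y, continuous f} -> {for y, continuous (fun z => f z 0 j)}.
Proof.
move=> fc; apply: (cvgrPdist_le (F := nbhs y) (fun z => f z 0 j) (f y 0 j)).2 => e e0; have /cvgrPdist_le/(_ _ e0) := fc.
apply: filterS => z; apply: le_trans; apply: le_trans (coord_norm_le _ j).
by rewrite !mxE.
Qed.

Lemma derivable_rowP m (f : 'rV[R]_n -> 'rV[R]_m) y v :
  derivable f y v <-> forall j, derivable (fun z => f z 0 j) y v.
Proof.
split; first by move/derivable_mxP => h j; exact: h.
by move=> h; apply/derivable_mxP => i j; rewrite ord1.
Qed.

Lemma derive_row m (f : 'rV[R]_n -> 'rV[R]_m) y v j : derivable f y v ->
  ('D_v f y) 0 j = 'D_v (fun z => f z 0 j) y.
Proof. by move=> fd; rewrite derive_mx // mxE. Qed.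

Lemma Ck_row k m (U : set 'rV[R]_n) (f : 'rV[R]_n -> 'rV[R]_m) : open U ->
  Ck k U f <-> (forall j, Ck k U (fun y => f y 0 j)).
Proof.
move=> Uo; elim: k f => [|k IH] f; split.
- by move=> [fc _] j; split=> // y /fc; exact: continuous_entry.
- by move=> fk; split=> // y Uy; apply: continuous_row => j; exact: Ck_continuous (fk j) Uy.
- move=> fk j; split.
    by move=> y Uy; apply/continuous_entry/(Ck_continuous fk Uy).
  move=> i; have fd y (Uy : U y) := Ck_derivable (i := i) fk Uy; split.
    by move=> y Uy; have /derivable_rowP := fd y Uy.
  apply: (@Ck_eq _ _ _ _ _ (fun y => ('D_(delta_mx 0 i) f y) 0 j)) => //.
    by move=> y Uy; apply: derive_row; exact: fd.
  by have /IH := Ck_derive i fk.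
move=> fk; split.
  by move=> y Uy; apply: continuous_row => j; exact: Ck_continuous (fk j) Uy.
move=> i; have fd y : U y -> derivable f y (delta_mx 0 i).
  by move=> Uy; apply/derivable_rowP => j; exact: Ck_derivable (fk j) Uy.
split=> //; apply/IH => j.
apply: (@Ck_eq _ _ _ _ _ ('D_(delta_mx 0 i) (fun y => f y 0 j))) => //.
  by move=> y Uy; rewrite derive_row //; exact: fd.
exact: Ck_derive.
Qed.

Lemma Ck_differentiable (U : set 'rV[R]_n) (f : 'rV[R]_n -> R) y : open U -> U y ->
  Ck 1 U f -> differentiable f y /\
  forall v, 'd f y v = \sum_i v 0 i * 'D_(delta_mx 0 i) f y.
Proof.
move=> Uo Uy fk; have /nbhs_ballP[d /= d0 dU] : nbhs y U by exact: open_nbhs_nbhs.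
apply: (C1_differentiable d0) => [z i zd|i].
  by apply: Ck_derivable fk _; apply: dU; rewrite -ball_normE /= distrC.
exact: Ck_continuous (Ck_derive i fk) Uy.
Qed.

Lemma Ck_row_differentiable m (U : set 'rV[R]_n) (f : 'rV[R]_n -> 'rV[R]_m) y :
  open U -> U y -> Ck 1 U f -> differentiable f y.
Proof.
move=> Uo Uy /(Ck_row _ _ Uo) fk.
have -> : f = \sum_(j < m) (fun z => f z 0 j *: (delta_mx 0 j : 'rV[R]_m)).
  by apply/funext => z; rewrite fct_sumE -row_sum_delta.
apply: differentiable_sum => j; apply: differentiableZl.
by have [] := Ck_differentiable Uo Uy (fk j).
Qed.

Lemma jacobian_entry m (U : set 'rV[R]_n) (f : 'rV[R]_n -> 'rV[R]_m) y i j :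
  open U -> U y -> Ck 1 U f -> ('J f y) i j = 'D_(delta_mx 0 i) (fun z => f z 0 j) y.
Proof.
move=> Uo Uy fk; rewrite mxE -deriveE; last exact: Ck_row_differentiable fk.
by rewrite derive_row //; exact: Ck_derivable fk Uy.
Qed.

Lemma smooth_on_jacobian m (U : set 'rV[R]_n) (f : 'rV[R]_n -> 'rV[R]_m) i j :
  open U -> smooth_on U f -> smooth_on U (fun y => 'J f y i j).
Proof.
move=> Uo fs k; apply: (@Ck_eq _ _ _ _ _ ('D_(delta_mx 0 i) (fun z => f z 0 j))) => //.
  by move=> y Uy; rewrite (jacobian_entry _ _ Uo Uy (fs 1%N)).
by apply: Ck_derive; have /(Ck_row _ _ Uo) := fs k.+1.
Qed.

Lemma smooth_on_row m (U : set 'rV[R]_n) (f : 'rV[R]_n -> 'rV[R]_m) : open U ->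
  smooth_on U f <-> (forall j, smooth_on U (fun y => f y 0 j)).
Proof.
move=> Uo; split=> [fs j k|fs k]; first by have /(Ck_row _ _ Uo) := fs k.
by apply/Ck_row => // j; exact: fs.
Qed.

End Rows.

Section ChainRule.
Context {R : realType} {n m : nat}.

Lemma Ck_sum k (U : set 'rV[R]_n) (I : Type) (r : seq I) (F : I -> 'rV[R]_n -> R) :
  open U -> (forall i, Ck k U (F i)) -> Ck k U (fun y => \sum_(i <- r) F i y).
Proof.
move=> Uo Fs; elim: r => [|i r IH].
  by rewrite (_ : (fun _ => _) = cst 0); [exact: Ck_cst|apply/funext => y; rewrite big_nil].
rewrite (_ : (fun _ => _) = (fun y => F i y + \sum_(j <- r) F j y)).
  exact: Ck_add.
by apply/funext => y; rewrite big_cons.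
Qed.

Lemma Ck_comp k (U : set 'rV[R]_n) (V : set 'rV[R]_m) (phi : 'rV[R]_n -> 'rV[R]_m)
    (g : 'rV[R]_m -> R) :
  open U -> open V -> (forall y, U y -> V (phi y)) ->
  Ck k U phi -> Ck k V g -> Ck k U (fun y => g (phi y)).
Proof.
move=> Uo Vo UV; elim: k g => [|k IH] g phik gk.
  split=> // y Uy; apply: continuous_comp; first exact: Ck_continuous phik Uy.
  exact: Ck_continuous gk (UV y Uy).
have phik' : Ck k U phi by exact: Ck_pred.
have D y (Uy : U y) i : is_derive y (delta_mx 0 i) (fun y => g (phi y))
    (\sum_j 'D_(delta_mx 0 i) (fun z => phi z 0 j) y * 'D_(delta_mx 0 j) g (phi y)).
  have g1 : Ck 1 V g by elim: (k) gk => // k' IHk gk; apply: IHk; exact: Ck_pred.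
  have [gd gdE] := Ck_differentiable Vo (UV y Uy) g1.
  have phid := Ck_derivable (i := i) phik Uy.
  have := is_derive_comp_line phid gd; rewrite gdE.
  by under eq_bigr do rewrite derive_row //.
split.
  move=> y Uy; apply: continuous_comp; first exact: Ck_continuous phik Uy.
  exact: Ck_continuous gk (UV y Uy).
move=> i; split; first by move=> y Uy; have [] := D y Uy i.
apply: (@Ck_eq _ _ _ _ _ (fun y => \sum_j 'D_(delta_mx 0 i) (fun z => phi z 0 j) y * 'D_(delta_mx 0 j) g (phi y))) => //.
  by move=> y Uy; have [_ ->] := D y Uy i.
apply: Ck_sum => // j; apply: Ck_mul => //.
  by apply: Ck_derive; have /(Ck_row _ _ Uo) := phik.
exact: (IH ('D_(delta_mx 0 j) g) phik' (Ck_derive j gk)).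
Qed.

Lemma smooth_on_comp (U : set 'rV[R]_n) (V : set 'rV[R]_m) (phi : 'rV[R]_n -> 'rV[R]_m)
    (g : 'rV[R]_m -> R) :
  open U -> open V -> (forall y, U y -> V (phi y)) ->
  smooth_on U phi -> smooth_on V g -> smooth_on U (fun y => g (phi y)).
Proof. by move=> Uo Vo UV ps gs k; exact: (Ck_comp Uo Vo UV). Qed.

End ChainRule.

Section SmoothMatrix.
Context {R : realType} {n : nat}.
Variable U : set 'rV[R]_n.
Hypothesis Uo : open U.

Definition smooth_mx_on p q (A : 'rV[R]_n -> 'M[R]_(p, q)) :=
  forall i j, smooth_on U (fun y => A y i j).

Lemma smooth_mx_cst p q (A : 'M[R]_(p, q)) : smooth_mx_on (fun=> A).
Proof. by move=> i j; exact: smooth_on_cst. Qed.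

Lemma smooth_mx_mul p q s (A : 'rV[R]_n -> 'M[R]_(p, q)) (B : 'rV[R]_n -> 'M[R]_(q, s)) :
  smooth_mx_on A -> smooth_mx_on B -> smooth_mx_on (fun y => A y *m B y).
Proof.
move=> As Bs i j; under eq_fun do rewrite mxE.
by apply: (@smooth_on_sum _ _ U _ _ _ (fun l y => A y i l * B y l j)) => // l _; apply: smooth_on_mul.
Qed.

Lemma smooth_mx_scale p q (a : 'rV[R]_n -> R) (A : 'rV[R]_n -> 'M[R]_(p, q)) :
  smooth_on U a -> smooth_mx_on A -> smooth_mx_on (fun y => a y *: A y).
Proof. by move=> us As i j; under eq_fun do rewrite mxE; exact: smooth_on_mul. Qed.

Lemma smooth_on_det p (A : 'rV[R]_n -> 'M[R]_p) :
  smooth_mx_on A -> smooth_on U (fun y => \det (A y)).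
Proof.
move=> As; rewrite /determinant; apply: (@smooth_on_sum _ _ U _ _ _ (fun (s : 'S_p) y => (-1) ^+ s * \prod_i A y i (s i))) => // s _.
apply: smooth_on_mul => //; first exact: (smooth_on_cst _ ((-1) ^+ s)).
by apply: (@smooth_on_prod _ _ U _ _ _ (fun i y => A y i (s i))) => // i _; exact: As.
Qed.

Lemma smooth_mx_adj p (A : 'rV[R]_n -> 'M[R]_p) :
  smooth_mx_on A -> smooth_mx_on (fun y => \adj (A y)).
Proof.
move=> As i j; under eq_fun do rewrite mxE.
rewrite /cofactor; apply: smooth_on_mul => //; first exact: (smooth_on_cst _ ((-1) ^+ (j + i))).
by apply: smooth_on_det => k l; under eq_fun do rewrite !mxE; exact: As.
Qed.

End SmoothMatrix.

(** * Charts and changes of coordinates *)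

Section Charts.
Context {R : realType} {n : nat} {M : manifold R n}.
Implicit Types (c : chart R n M) (x : M) (f : M -> R).

Definition chart_image c : set 'rV[R]_n := coord c @` dom c.

Lemma atlas_chart_at x : atlas (chart_at x).
Proof. exact: s2valP. Qed.

Lemma dom_chart_at x : dom (chart_at x) x.
Proof. exact: (s2valP' (cid2 (atlas_cover x))). Qed.

Lemma chart_image_coord c x : dom c x -> chart_image c (coord c x).
Proof. by move=> cx; exists x. Qed.

Lemma chart_imageP c y : chart_image c y -> dom c (param c y) /\ coord c (param c y) = y.
Proof. by move=> [x cx <-]; rewrite coordK. Qed.

Definition chart_preimage c (A : set M) : set 'rV[R]_n := [set y | chart_image c y /\ A (param c y)].

Lemma open_chart_preimage c A : open A -> open (chart_preimage c A).
Proof.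
move=> Ao; rewrite openE => y [iy Ay].
have i1 : nbhs y (chart_image c) := open_nbhs_nbhs (conj (@open_im _ _ _ c) iy).
have i2 : nbhs y (param c @^-1` A).
  exact: (param_cont iy (open_nbhs_nbhs (conj Ao Ay))).
by apply: filterS2 i1 i2 => z; split.
Qed.

Lemma open_chart_image c : open (chart_image c). Proof. exact: open_im. Qed.

Lemma chart_preimage_dom c c' : coord c @` (dom c `&` dom c') = chart_preimage c (dom c').
Proof.
apply/seteqP; split=> y /=.
  by move=> [x [cx c'x] <-]; split; [exact: chart_image_coord|rewrite coordK].
by move=> [/chart_imageP[cy yE] c'y]; exists (param c y).
Qed.

Definition transition c c' := coord c' \o param c.

Lemma smooth_transition c c' : atlas c -> atlas c' -> smooth_on (chart_preimage c (dom c')) (transition c c').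
Proof. by move=> ac ac'; rewrite -chart_preimage_dom; exact: atlas_smooth. Qed.

Lemma open_chart_preimage_dom c c' : open (chart_preimage c (dom c')).
Proof. exact/open_chart_preimage/open_dom. Qed.

(** The Jacobian matrix is a matrix of partial derivatives, hence local. *)
Lemma jacobian_near m (f g : 'rV[R]_n -> 'rV[R]_m) (U : set 'rV[R]_n) y :
  open U -> U y -> (forall z, U z -> f z = g z) -> smooth_on U f -> 'J f y = 'J g y.
Proof.
move=> Uo Uy fg fs; have gs : smooth_on U g by move=> k; exact: Ck_eq (fs k).
apply/matrixP => i j.
apply: etrans (jacobian_entry i j Uo Uy (fs 1%N)) _.
apply: etrans _ (esym (jacobian_entry i j Uo Uy (gs 1%N))).
apply: near_eq_derive; apply: filterS (open_nbhs_nbhs (conj Uo Uy)) => z Uz.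
by rewrite fg.
Qed.

Lemma jacobian_comp m p (f : 'rV[R]_n -> 'rV[R]_m) (g : 'rV[R]_m -> 'rV[R]_p) y :
  differentiable f y -> differentiable g (f y) -> 'J (g \o f) y = 'J f y *m 'J g (f y).
Proof.
move=> fd gd; apply/row_matrixP => i; rewrite rowE [RHS]rowE mulmxA !mul_rV_lin1.
by rewrite diff_comp.
Qed.

Lemma jacobian_id (y : 'rV[R]_n) : 'J (fun z : 'rV[R]_n => z) y = 1%:M.
Proof.
apply/row_matrixP => i; rewrite rowE [RHS]rowE mulmx1 mul_rV_lin1.
by have [_ ->] := is_diff_id y.
Qed.

Lemma differentiable_transition c c' x : atlas c -> atlas c' -> dom c x -> dom c' x ->
  differentiable (transition c c') (coord c x).
Proof.
move=> ac ac' cx c'x.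
have px : chart_preimage c (dom c') (coord c x) by split; [exact: chart_image_coord|rewrite coordK].
exact: (Ck_row_differentiable (@open_chart_preimage_dom c c') px (smooth_transition ac ac' 1%N)).
Qed.

(** The cocycle rule of the changes of coordinates: the chain rule for the
    transition maps, which compose near the point. *)
Lemma change_comp c c' c'' x : atlas c -> atlas c' -> atlas c'' ->
  dom c x -> dom c' x -> dom c'' x ->
  change c c' x *m change c' c'' x = change c c'' x.
Proof.
move=> ac ac' ac'' cx c'x c''x; rewrite /change.
have tx : transition c c' (coord c x) = coord c' x by rewrite /transition /= coordK.
have <- := @jacobian_near n (transition c' c'' \o transition c c') (transition c c'')
  (chart_preimage c (dom c' `&` dom c'')) (coord c x); last 4 first.
- by apply: open_chart_preimage; apply: openI; exact: open_dom.
- by split; [exact: chart_image_coord|rewrite coordK].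
- by move=> y [iy [c'y c''y]]; rewrite /transition /= coordK.
- move=> k; apply: (@Ck_eq _ _ _ _ _ (transition c c'')).
  + by apply: open_chart_preimage; apply: openI; exact: open_dom.
  + by move=> y [iy [c'y c''y]]; rewrite /transition /= coordK.
  + by apply: Ck_sub (smooth_transition ac ac'' k) => y [iy [c'y c''y]].
rewrite jacobian_comp ?tx //; first exact: differentiable_transition.
exact: differentiable_transition.
Qed.

Lemma change_id c x : dom c x -> change c c x = 1%:M.
Proof.
move=> cx; rewrite /change -(jacobian_id (coord c x)); symmetry.
apply: (@jacobian_near n _ _ (chart_image c)).
- exact: open_chart_image.
- exact: chart_image_coord.
- by move=> z /chart_imageP[_ e]; rewrite /= e.
- by move=> k; apply/Ck_row; [exact: open_chart_image|move=> j; exact: smooth_on_coord].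
Qed.

Lemma change_inv c c' x : atlas c -> atlas c' -> dom c x -> dom c' x ->
  change c c' x *m change c' c x = 1%:M.
Proof. by move=> ac ac' cx c'x; rewrite change_comp // change_id. Qed.

End Charts.

(** * Smooth functions, vector fields and forms *)

Section SmoothObjects.
Context {R : realType} {n : nat} {M : manifold R n}.
Implicit Types (c : chart R n M) (x : M) (f g : M -> R) (X Y : vector_field M).

Lemma smooth_cst (k : R) : smooth (fun _ : M => k).
Proof. by move=> c _; exact: smooth_on_cst. Qed.

Lemma smooth_mul f g : smooth f -> smooth g -> smooth (fun x => f x * g x).
Proof.
by move=> fs gs c ac; apply: (smooth_on_mul (@open_chart_image _ _ _ c)); [exact: fs|exact: gs].
Qed.

Lemma smooth_affine (a b : R) f : smooth f -> smooth (fun x => a + b * f x).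
Proof.
move=> fs c ac; apply: (smooth_on_add (@open_chart_image _ _ _ c) (smooth_on_cst (chart_image c) a)).
exact: (smooth_on_mul (@open_chart_image _ _ _ c) (smooth_on_cst (chart_image c) b) (fs c ac)).
Qed.

Lemma smooth_expR f : smooth f -> smooth (fun x => expR (f x)).
Proof. by move=> fs c ac; exact: (smooth_on_expR (@open_chart_image _ _ _ c) (fs c ac)). Qed.

Lemma smooth_flat f : smooth f -> smooth (fun x => flat 1 (f x)).
Proof. by move=> fs c ac; exact: (smooth_on_flat (@open_chart_image _ _ _ c) (fs c ac)). Qed.

Lemma smooth_inv f : (forall x, f x != 0) -> smooth f -> smooth (fun x => (f x)^-1).
Proof.
move=> f0 fs c ac; apply: (smooth_on_inv (@open_chart_image _ _ _ c) _ (fs c ac)).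
by move=> y _; exact: f0.
Qed.

Definition field_coord X c y : 'rV[R]_n :=
  X (param c y) *m change (chart_at (param c y)) c (param c y).

Lemma smooth_field_intro X : (forall c, atlas c -> smooth_mx_on (chart_image c) (field_coord X c)) ->
  smooth_field X.
Proof.
move=> h c ac; apply/smooth_on_row; first exact: open_chart_image.
by move=> j; exact: (h c ac 0 j).
Qed.

Lemma smooth_field_elim X c : atlas c -> smooth_field X -> smooth_mx_on (chart_image c) (field_coord X c).
Proof.
move=> ac Xs i j; rewrite ord1.
by have /smooth_on_row := Xs c ac; apply; exact: open_chart_image.
Qed.

Lemma field_coordE X c x : dom c x -> field_coord X c (coord c x) = X x *m change (chart_at x) c x.
Proof. by move=> cx; rewrite /field_coord coordK. Qed.

(** The components of X x in the preferred chart, recovered from those in an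
    arbitrary chart. *)
Lemma field_coordK X c x : atlas c -> dom c x ->
  field_coord X c (coord c x) *m change c (chart_at x) x = X x.
Proof.
move=> ac cx; rewrite (field_coordE X cx) -mulmxA.
by rewrite (change_inv (atlas_chart_at x) ac (dom_chart_at x) cx) mulmx1.
Qed.

Lemma field_coord_change X c c' z : atlas c -> atlas c' -> dom c (param c' z) ->
  dom c' (param c' z) ->
  field_coord X c' z = field_coord X c (transition c' c z) *m
    change c c' (param c (transition c' c z)).
Proof.
move=> ac ac' cz c'z; set x := param c' z in cz c'z *.
have tE : transition c' c z = coord c x by [].
rewrite tE (field_coordE X cz) (coordK cz) -mulmxA.
rewrite (change_comp (atlas_chart_at x) ac ac' (dom_chart_at x) cz c'z).
reflexivity.
Qed.

Lemma smooth_mx_comp m p q (U : set 'rV[R]_n) (V : set 'rV[R]_m) phi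
    (A : 'rV[R]_m -> 'M[R]_(p, q)) :
  open U -> open V -> (forall y, U y -> V (phi y)) -> smooth_on U phi ->
  smooth_mx_on V A -> smooth_mx_on U (fun y => A (phi y)).
Proof.
move=> Uo Vo UV ps As i j.
exact: (smooth_on_comp Uo Vo UV ps (As i j)).
Qed.

Lemma smooth_mx_on_sub p q (U V : set 'rV[R]_n) (A : 'rV[R]_n -> 'M[R]_(p, q)) :
  V `<=` U -> smooth_mx_on U A -> smooth_mx_on V A.
Proof. by move=> VU As i j k; exact: Ck_sub VU (As i j k). Qed.

Lemma smooth_change c c' : atlas c -> atlas c' ->
  smooth_mx_on (chart_preimage c (dom c')) (fun y => change c c' (param c y)).
Proof.
move=> ac ac' i j k; have Js := smooth_on_jacobian i j (@open_chart_preimage_dom _ _ _ c c') (smooth_transition ac ac').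
apply: Ck_eq (Js k); first exact: open_chart_preimage_dom.
by move=> y [/chart_imageP[_ yE] _]; rewrite /change yE.
Qed.

(** Smoothness is local, and one chart around each point suffices, since the
    change of coordinates is itself smooth.  This is how fields defined by cases
    or by gluing are shown to be smooth. *)
Lemma smooth_field_local X :
  (forall x, exists c (V : set 'rV[R]_n),
     [/\ atlas c, dom c x, open V, V `<=` chart_image c & V (coord c x)] /\
     smooth_mx_on V (field_coord X c)) ->
  smooth_field X.
Proof.
move=> loc; apply: smooth_field_intro => c' ac' i j.
apply: smooth_on_cover => y /chart_imageP[c'x yE]; set x := param c' y in c'x yE.
have [c [V [[ac cx Vo Vim Vx] Xs]]] := loc x.
pose W := chart_preimage c (dom c') `&` V.
have Wo : open W by apply: openI => //; exact: open_chart_preimage_dom.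
(* The part of M where the chart c exhibits the smoothness of X. *)
pose A := [set p | dom c p /\ V (coord c p)].
have Ao : open A.
  rewrite openE => p [cp Vp]; have cpn : nbhs p (dom c).
    exact: open_nbhs_nbhs (conj (@open_dom _ _ _ c) cp).
  have := coord_cont cp (open_nbhs_nbhs (conj Vo Vp)).
  by move: cpn; apply: filterS2 => z; split.
exists (chart_preimage c' A), (fun z => (field_coord X c (transition c' c z) *m change c c' (param c (transition c' c z))) i j).
split.
- exact: open_chart_preimage.
- by split; [rewrite -yE; exact: chart_image_coord|split].
- move=> z [/chart_imageP[c'z zE] [cz Vz]].
  exact: (congr1 (fun u : 'rV[R]_n => u i j) (field_coord_change X ac ac' cz c'z)).
- apply: (@smooth_mx_comp n 1 n (chart_preimage c' A) W (transition c' c)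
    (fun w => field_coord X c w *m change c c' (param c w))).
  + exact: open_chart_preimage.
  + exact: Wo.
  + move=> z [/chart_imageP[c'z zE] [cz Vz]]; split=> //; split; first exact: chart_image_coord.
    by rewrite /transition /= coordK.
  + move=> k; apply: Ck_sub (smooth_transition ac' ac k) => z [iz [cz _]].
    by split.
  + apply: smooth_mx_mul => //.
      by apply: smooth_mx_on_sub Xs => z [].
    by apply: smooth_mx_on_sub (smooth_change ac ac') => z [].
Qed.

Lemma smooth_field_add X Y : smooth_field X -> smooth_field Y ->
  smooth_field (fun x => X x + Y x).
Proof.
move=> Xs Ys; apply: smooth_field_intro => c ac i j.
rewrite (_ : (fun y => _) = (fun y => field_coord X c y i j + field_coord Y c y i j)).
  apply: smooth_on_add; [exact: open_chart_image|exact: smooth_field_elim|exact: smooth_field_elim].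
by apply/funext => y; rewrite /field_coord mulmxDl mxE.
Qed.

Lemma smooth_field_scale f X : smooth f -> smooth_field X ->
  smooth_field (fun x => f x *: X x).
Proof.
move=> fs Xs; apply: smooth_field_intro => c ac i j.
rewrite (_ : (fun y => _) = (fun y => f (param c y) * field_coord X c y i j)).
  apply: smooth_on_mul; [exact: open_chart_image|exact: fs|exact: smooth_field_elim].
by apply/funext => y; rewrite /field_coord -scalemxAl mxE.
Qed.

Lemma smooth_field0 : smooth_field (fun _ : M => 0).
Proof.
apply: smooth_field_intro => c ac i j.
rewrite (_ : (fun y => _) = cst 0); first exact: smooth_on_cst.
by apply/funext => y; rewrite /field_coord mul0mx mxE.
Qed.

Lemma smooth_pairing (t : form_family M 1) X : is_form t -> smooth_field X ->
  smooth (fun x => t x (X x)).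
Proof.
move=> [ta ts] Xs c ac.
pose g y i := t (param c y) (delta_mx 0 i *m change c (chart_at (param c y)) (param c y)).
have gs : smooth_on (chart_image c) (fun y => \sum_i field_coord X c y 0 i * g y i).
  apply: (@smooth_on_sum _ _ (chart_image c) _ _ _ (fun i y => field_coord X c y 0 i * g y i)).
    exact: open_chart_image.
  move=> i _; apply: smooth_on_mul; first exact: open_chart_image.
    exact: smooth_field_elim.
  exact: (ts c ac (delta_mx 0 i)).
move=> k; apply: Ck_eq (gs k); first exact: open_chart_image.
move=> y /chart_imageP[cx yE] /=; set x := param c y in cx yE *.
have tm : multilinear (t x) by have [] := ta x.
rewrite -(field_coordK X ac cx) yE {2}[field_coord X c y]row_sum_delta mulmx_suml.
under [in RHS]eq_bigr do rewrite -scalemxAl.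
rewrite (@linear_law_sum R n 'I_n (t x) (field_coord X c y 0)
  (fun i => delta_mx 0 i *m change c (chart_at x) x)) //.
by move=> s v v'; exact: multilinear1P.
Qed.

End SmoothObjects.

Section Forms.
Context {R : realType} {n : nat} {M : manifold R n}.

Lemma wedgeE p q (a : form_family M p) (b : form_family M q) x A :
  wedge a b x A = wedge_at (a x) (b x) A.
Proof.
by rewrite /wedge /wedge_at; congr (_ * _); apply: eq_bigr => s _; rewrite -mulrA.
Qed.

Lemma wedge_powE (w : form_family M 2) r x : wedge_pow w r x = wedge_pow_at (w x) r.
Proof.
elim: r => [//|r IH] /=; apply/funext => A.
by rewrite (wedgeE w (wedge_pow w r)) IH.
Qed.

Lemma is_form_antisym k (a : form_family M k) x : is_form a -> antisym (a x).
Proof. by move=> [/(_ x)[am aa] _]; exact: multilinear_antisym. Qed.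

Lemma is_form_scale k (g : M -> R) (a : form_family M k) : smooth g -> is_form a ->
  is_form (form_scale g a).
Proof.
move=> gs [aa as_]; split=> [x|c ac A].
  have [am aalt] := aa x; split; first exact: multilinear_scale.
  by move=> i j A ij rA; rewrite /form_scale (aalt i j) ?mulr0.
by apply: (smooth_on_mul (@open_chart_image _ _ _ c)); [exact: gs|exact: as_].
Qed.

Lemma is_form_add k (a b : form_family M k) : is_form a -> is_form b ->
  is_form (form_add a b).
Proof.
move=> [aa as_] [ba bs]; split=> [x|c ac A].
  have [am aalt] := aa x; have [bm balt] := ba x; split; first exact: multilinear_add.
  by move=> i j A ij rA; rewrite /form_add (aalt i j) // (balt i j) // addr0.
by apply: (smooth_on_add (@open_chart_image _ _ _ c)); [exact: as_|exact: bs].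
Qed.

Lemma is_form_wedge p q (a : form_family M p) (b : form_family M q) :
  is_form a -> is_form b -> is_form (wedge a b).
Proof.
move=> [aa as_] [ba bs]; split=> [x|c ac A].
  have wE : wedge a b x = wedge_at (a x) (b x) by apply/funext => A; exact: wedgeE.
  rewrite wE; have [am _] := aa x; have [bm _] := ba x.
  split; first exact: multilinear_wedge_at.
  exact/antisym_alternating/wedge_at_antisym.
pose J y := change c (chart_at (param c y)) (param c y).
pose F (s : 'S_(p + q)) y := (-1) ^+ s *
  (a (param c y) (usubmx (row_perm s A) *m J y) * b (param c y) (dsubmx (row_perm s A) *m J y)).
rewrite (_ : (fun y => _) = (fun y => (p`!%:R * q`!%:R)^-1 * \sum_s F s y)).
  apply: (smooth_on_mul (@open_chart_image _ _ _ c) (smooth_on_cst (chart_image c) _)).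
  apply: (@smooth_on_sum _ _ (chart_image c) _ _ _ F) => [|s _]; first exact: open_chart_image.
  apply: (smooth_on_mul (@open_chart_image _ _ _ c) (smooth_on_cst (chart_image c) _)).
  apply: (smooth_on_mul (@open_chart_image _ _ _ c)); first exact: (as_ c ac).
  exact: (bs c ac).
apply/funext => y; rewrite wedgeE /wedge_at; congr (_ * _); apply: eq_bigr => s _.
by rewrite /F /tensor !mul_usub_mx !mul_dsub_mx !row_permE !mulmxA.
Qed.

Lemma multilinear_linear (a : {linear 'rV[R]_n -> R}) : multilinear (a : 'M[R]_(1, n) -> R).
Proof.
move=> i s A B C rA _ _.
have rowE1 (D : 'M[R]_(1, n)) : row i D = D by apply/rowP => j; rewrite !mxE ord1.
by move: rA; rewrite !rowE1 => ->; rewrite linearP.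
Qed.

(** The differential is defined through the preferred chart; by the chain rule,
    any chart gives the same linear form. *)
Lemma differential_chart (f : M -> R) c x v : smooth f -> atlas c -> dom c x ->
  differential f x (v *m change c (chart_at x) x) =
  \sum_i v 0 i * 'D_(delta_mx 0 i) (f \o param c) (coord c x).
Proof.
move=> fs ac cx; set c0 := chart_at x.
have c0x : dom c0 x := dom_chart_at x.
have ac0 : atlas c0 := atlas_chart_at x.
have dfc c' : atlas c' -> dom c' x -> differentiable (f \o param c') (coord c' x) /\
    forall u, 'd (f \o param c') (coord c' x) u =
      \sum_i u 0 i * 'D_(delta_mx 0 i) (f \o param c') (coord c' x).
  by move=> ac' c'x; exact: (Ck_differentiable (@open_chart_image _ _ _ c') (chart_image_coord c'x) (fs c' ac' 1%N)).
have [fd fdE] := dfc c ac cx; have [fd0 _] := dfc c0 ac0 c0x.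
rewrite -fdE -(deriveE _ fd) /differential -/c0.
have td := differentiable_transition ac ac0 cx c0x.
have tx : transition c c0 (coord c x) = coord c0 x by rewrite /transition /= coordK.
transitivity ('D_v ((f \o param c0) \o transition c c0) (coord c x)).
  have fd0' : differentiable (f \o param c0) (transition c c0 (coord c x)) by rewrite tx.
  have cd := differentiable_comp td fd0'.
  apply: etrans _ (esym (deriveE v cd)).
  apply: etrans _ (esym (congr1 (fun h : 'rV[R]_n -> R => h v) (diff_comp td fd0'))).
  have vJ : v *m change c c0 x = 'd (transition c c0) (coord c x) v := mul_rV_lin1 _ v.
  apply: etrans (congr1 ('d (f \o param c0) (coord c0 x)) vJ) _.
  exact: (congr1 (fun p => 'd (f \o param c0) p ('d (transition c c0) (coord c x) v)) (esym tx)).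
apply: near_eq_derive.
have px : chart_preimage c (dom c0) (coord c x) by split; [exact: chart_image_coord|rewrite coordK].
apply: filterS (open_nbhs_nbhs (conj (@open_chart_preimage_dom _ _ _ c c0) px)) => z [_ c0z].
by rewrite /transition /= coordK.
Qed.

Lemma is_form_differential (f : M -> R) : smooth f -> is_form (differential f).
Proof.
move=> fs; split=> [x|c ac A].
  split; first exact: multilinear_linear.
  by move=> i j; rewrite !ord1.
have gs : smooth_on (chart_image c) (fun y => \sum_i A 0 i * 'D_(delta_mx 0 i) (f \o param c) y).
  apply: (@smooth_on_sum _ _ (chart_image c) _ _ _ (fun i y => A 0 i * 'D_(delta_mx 0 i) (f \o param c) y)).
    exact: open_chart_image.
  move=> i _; apply: (smooth_on_mul (@open_chart_image _ _ _ c) (smooth_on_cst (chart_image c) _)).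
  by move=> k; apply: Ck_derive; exact: fs.
move=> k; apply: Ck_eq (gs k); first exact: open_chart_image.
move=> y /chart_imageP[cx yE].
by have e := differential_chart A fs ac cx; rewrite yE in e; exact: esym e.
Qed.

End Forms.

(** * Local Reeb fields *)

Section Bump.
Context {R : realType} {n : nat}.
Variables (y0 : 'rV[R]_n) (d : R).

(** Positive inside the Euclidean ball of radius d around y0 and zero outside, so
    its support lies in the ball of the sup norm. *)
Definition bump (y : 'rV[R]_n) : R := flat 1 (d ^+ 2 + (-1) * \sum_i (y 0 i - y0 0 i) ^+ 2).

Lemma smooth_on_bump U : open U -> smooth_on U bump.
Proof.
move=> Uo; apply: smooth_on_flat => //.
apply: (smooth_on_add Uo (smooth_on_cst U (d ^+ 2))).
apply: (smooth_on_mul Uo (smooth_on_cst U (-1))).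
apply: (@smooth_on_sum _ _ U _ _ _ (fun i y => (y 0 i - y0 0 i) ^+ 2)) => // i _.
have h : smooth_on U (fun y => y 0 i - y0 0 i).
  exact: (smooth_on_add Uo (smooth_on_coord U i) (smooth_on_cst U (- y0 0 i))).
exact: (smooth_on_mul Uo h h).
Qed.

Lemma bump_gt0 : 0 < d -> 0 < bump y0.
Proof.
move=> d0; apply: flat_gt0; rewrite big1 => [|i _]; first by rewrite mulr0 addr0 exprn_gt0.
by rewrite subrr expr0n.
Qed.

Lemma bump_ge0 y : 0 <= bump y. Proof. exact: flat_ge0. Qed.

Lemma bump_eq0 y : 0 < d -> ~ `|y0 - y| <= d -> bump y = 0.
Proof.
move=> d0 yd; apply: flat_le0.
have [i yi] : exists i, d < `|(y0 - y) 0 i|.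
  apply: contrapT => h; apply: yd; apply: norm_le_coord; first exact: ltW.
  by move=> i; rewrite leNgt; apply/negP => hi; apply: h; exists i.
rewrite mulN1r subr_le0 (bigD1 i) //=; apply: (@le_trans _ _ ((y 0 i - y0 0 i) ^+ 2)).
  rewrite -[leRHS]real_normK ?num_real // distrC; move: yi; rewrite !mxE => yi.
  by rewrite ler_sqr ?nnegrE ?normr_ge0 // ltW.
by rewrite lerDl sumr_ge0 // => j _; exact: sqr_ge0.
Qed.

End Bump.

(** A matrix N varying smoothly with constant rank has smooth solutions of
    z N = e: compress N to an invertible square matrix by frames adapted to the
    value N0 at a base point, and apply Cramer's rule.  Multiplying the solution by
    the square of the determinant makes it polynomial in N, valid also where the
    compressed matrix degenerates, and of nonnegative right-hand side. *)
Section LocalSolution.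
Context {R : realType} {n p : nat}.
Variables (N0 N : 'M[R]_(n, p)) (e : 'rV[R]_p).

Definition minor_frame : 'M[R]_(\rank N0) :=
  pinvmx (col_base N0) *m N *m pinvmx (row_base N0).

Definition cramer_row : 'rV[R]_n :=
  \det minor_frame *: (e *m pinvmx (row_base N0) *m \adj minor_frame *m pinvmx (col_base N0)).

Lemma cramer_rowP : \rank N = \rank N0 -> (exists u, u *m N = e) ->
  cramer_row *m N = (\det minor_frame ^+ 2) *: e.
Proof.
move=> rN [u uN]; rewrite /cramer_row; set D := minor_frame; set P := pinvmx (col_base N0).
set Q := pinvmx (row_base N0).
have [D0|D0] := eqVneq (\det D) 0; first by rewrite D0 scale0r mul0mx expr0n scale0r.
have Du : D \in unitmx by rewrite unitmxE unitfE.
have sN : (N <= P *m N)%MS.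
  have /mxrank_leqif_sup[le1 <-] : (P *m N <= N)%MS by exact: submxMl.
  rewrite eqn_leq le1 rN -{1}(mxrank_unit Du) /D /minor_frame.
  exact: mxrankM_maxl.
have [z ze] : exists z, e = z *m (P *m N).
  by apply/submxP; rewrite -uN; apply: submx_trans (submxMl u N) sN.
have h : z *m (P *m N) *m Q *m \adj D = \det D *: z.
  by rewrite -(mulmxA z (P *m N) Q) -[P *m N *m Q]/D -mulmxA mul_mx_adj mul_mx_scalar.
by rewrite {1}ze h -!scalemxAl scalerA -expr2 -mulmxA -ze.
Qed.

End LocalSolution.

Lemma det_minor_frame (R : realType) n p (N0 : 'M[R]_(n, p)) : \det (minor_frame N0 N0) = 1.
Proof.
have PN : pinvmx (col_base N0) *m N0 = row_base N0.
  transitivity (pinvmx (col_base N0) *m (col_base N0 *m row_base N0)).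
    by rewrite mulmx_base.
  by rewrite mulmxA mulVpmx ?col_base_full // mul1mx.
by rewrite /minor_frame PN mulmxVp ?row_base_free // det1.
Qed.

Lemma mul_col2 (R : realType) n (u v : 'rV[R]_n) (J : 'M[R]_n) :
  (col_mx u v : 'M[R]_(2, n)) *m J = (col_mx (u *m J) (v *m J) : 'M[R]_(2, n)).
Proof. exact: (mul_col_mx u v J). Qed.

Lemma row_mul_col (R : realType) m n p (A : 'M[R]_(m, n)) (B : 'M[R]_(n, p)) i j :
  (row i A *m col j B) 0 0 = (A *m B) i j.
Proof.
by rewrite [LHS]mxE [RHS]mxE; apply: eq_bigr => k _; rewrite [row _ _ _ _]mxE [col _ _ _ _]mxE.
Qed.

Section LocalReeb.
Context {R : realType} {n : nat} {M : manifold R n}.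
Variables (tau : form_family M 1) (omega : form_family M 2) (r : nat).
Hypothesis twD : doublet_of_class (2 * r + 1) tau omega.

Let tauF : is_form tau. Proof. by case: twD. Qed.
Let omegaF : is_form omega. Proof. by case: twD. Qed.
Let tm x : multilinear (tau x). Proof. by case: tauF => /(_ x)[]. Qed.
Let wm x : multilinear (omega x). Proof. by case: omegaF => /(_ x)[]. Qed.
Let wa x : antisym (omega x). Proof. exact: is_form_antisym. Qed.
Let cl x : has_codim (Ker (k := 0) (tau x) `&` Ker (k := 1) (omega x)) (2 * r + 1).
Proof. by case: twD => _ _ /(_ x). Qed.

Section InChart.
Variable c : chart R n M.
Hypothesis ac : atlas c.

Definition frame_change y : 'M[R]_n := change c (chart_at (param c y)) (param c y).

(** The matrix of v |-> (i_v omega, tau v) in the frame of the chart c. *)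
Definition chart_pairmx y : 'M[R]_(n, n + 1) :=
  row_mx
    (\matrix_(i, j) omega (param c y)
       ((col_mx (delta_mx 0 i : 'rV[R]_n) (delta_mx 0 j : 'rV[R]_n) : 'M[R]_(2, n)) *m frame_change y))
    (\col_i tau (param c y) ((delta_mx 0 i : 'rV[R]_n) *m frame_change y)).

Lemma smooth_chart_pairmx : smooth_mx_on (chart_image c) chart_pairmx.
Proof.
move=> i j; rewrite /chart_pairmx.
case: (split_ordP j) => k ->.
  rewrite (_ : (fun y => _) = (fun y => omega (param c y) ((col_mx (delta_mx 0 i : 'rV[R]_n) (delta_mx 0 k : 'rV[R]_n) : 'M[R]_(2, n)) *m frame_change y))).
    by case: omegaF => _ /(_ c ac); apply.
  by apply/funext => y; rewrite row_mxEl mxE.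
rewrite (_ : (fun y => _) = (fun y => tau (param c y) ((delta_mx 0 i : 'rV[R]_n) *m frame_change y))).
  by case: tauF => _ /(_ c ac); apply.
by apply/funext => y; rewrite row_mxEr mxE.
Qed.

(** The chart expression is the one in the preferred frame up to invertible
    factors, so its rank is the class of the doublet. *)
Lemma chart_pairmxE y (J := frame_change y) (x := param c y) :
  chart_pairmx y = J *m pairmx (tau x) (omega x) *m block_mx J^T 0 0 1%:M.
Proof.
rewrite /chart_pairmx /pairmx mul_mx_row mul_row_block !mulmx0 addr0 add0r mulmx1.
congr row_mx; apply/matrixP => i j.
  rewrite [LHS]mxE mul_col2 -!rowE gramE // -row_mul tr_row.
  exact: row_mul_col.
rewrite [LHS]mxE -rowE (covecE _ (tm _)) ord1 -row_mul.
by rewrite [LHS]mxE.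
Qed.

Definition reeb_rhs : 'rV[R]_(n + 1) := row_mx 0 1%:M.

Definition frame_change_inv y : 'M[R]_n := change (chart_at (param c y)) c (param c y).

Lemma frame_changeK y : chart_image c y -> frame_change y *m frame_change_inv y = 1%:M.
Proof.
move=> /chart_imageP[cx _].
exact: (change_inv ac (atlas_chart_at _) cx (dom_chart_at _)).
Qed.

Lemma frame_changeVK y : chart_image c y -> frame_change_inv y *m frame_change y = 1%:M.
Proof.
move=> /chart_imageP[cx _].
exact: (change_inv (atlas_chart_at _) ac (dom_chart_at _) cx).
Qed.

Let blockK y : chart_image c y ->
  block_mx (frame_change y)^T 0 0 1%:M *m block_mx (frame_change_inv y)^T 0 0 (1%:M : 'M[R]_1) = 1%:M.
Proof.
move=> iy; rewrite mulmx_block !mulmx0 !mul0mx !addr0 !add0r mulmx1 -trmx_mul.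
by rewrite (frame_changeVK iy) trmx1 -scalar_mx_block.
Qed.

Lemma rank_chart_pairmx y : chart_image c y -> \rank (chart_pairmx y) = (2 * r + 1)%N.
Proof.
move=> iy; rewrite chart_pairmxE mxrankMfree; last first.
  by apply/row_freeP; exists (block_mx (frame_change_inv y)^T 0 0 1%:M); exact: blockK.
rewrite -(rank_pairmx (tm _) (wm _) (cl (param c y))).
have Jfull : row_full (frame_change y).
  by apply/row_fullP; exists (frame_change_inv y); exact: frame_changeVK.
by rewrite (eqmxMfull _ Jfull).
Qed.

Lemma chart_pairmx_solution y (v : 'rV[R]_n) s : chart_image c y ->
  v *m chart_pairmx y = s *: reeb_rhs <->
  (v *m frame_change y) *m gram (omega (param c y)) = 0 /\
  tau (param c y) (v *m frame_change y) = s.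
Proof.
move=> iy; rewrite chart_pairmxE /pairmx !mulmxA.
set u := v *m frame_change y; set x := param c y.
rewrite mul_mx_row mul_row_block !mulmx0 addr0 add0r mulmx1 /reeb_rhs scale_row_mx scaler0.
rewrite (covecE u (tm x)); split.
  move=> /eq_row_mx[h1 ->]; split; last by rewrite !mxE mulr1.
  rewrite -[LHS]mulmx1 -trmx1 -(frame_changeVK iy) trmx_mul mulmxA h1.
  by rewrite mul0mx.
case=> h1 h2; congr row_mx; first by rewrite h1 mul0mx.
by apply/matrixP => i j; rewrite !ord1 h2 !mxE mulr1.
Qed.

Lemma chart_reeb y : chart_image c y -> exists u, u *m chart_pairmx y = reeb_rhs.
Proof.
move=> iy; have [X [Xw tX]] := reeb_vector (tm _) (wm _) (wa _) (cl (param c y)).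
exists (X *m frame_change_inv y); rewrite -[RHS]scale1r; apply/(chart_pairmx_solution _ _ iy).
have e : X *m frame_change_inv y *m frame_change y = X.
  by rewrite -mulmxA (frame_changeVK iy) mulmx1.
split; last exact: etrans (congr1 (tau (param c y)) e) tX.
exact: etrans (congr1 (fun u : 'rV[R]_n => u *m gram (omega (param c y))) e) Xw.
Qed.

Variable y0 : 'rV[R]_n.
Hypothesis iy0 : chart_image c y0.

Definition local_reeb y : 'rV[R]_n :=
  cramer_row (chart_pairmx y0) (chart_pairmx y) reeb_rhs.

Definition local_speed y : R := \det (minor_frame (chart_pairmx y0) (chart_pairmx y)) ^+ 2.

Lemma local_speed1 : local_speed y0 = 1.
Proof. by rewrite /local_speed det_minor_frame expr1n. Qed.

Lemma local_reebP y : chart_image c y ->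
  (local_reeb y *m frame_change y) *m gram (omega (param c y)) = 0 /\
  tau (param c y) (local_reeb y *m frame_change y) = local_speed y.
Proof.
move=> iy; apply/(chart_pairmx_solution _ _ iy)/cramer_rowP; last exact: chart_reeb.
exact: etrans (rank_chart_pairmx iy) (esym (rank_chart_pairmx iy0)).
Qed.

Lemma smooth_local_reeb : smooth_mx_on (chart_image c) local_reeb.
Proof.
have io := @open_chart_image _ _ _ c.
have Ds : smooth_mx_on (chart_image c) (fun y => minor_frame (chart_pairmx y0) (chart_pairmx y)).
  apply: smooth_mx_mul => //; last exact: smooth_mx_cst.
  by apply: smooth_mx_mul => //; [exact: smooth_mx_cst|exact: smooth_chart_pairmx].
apply: smooth_mx_scale => //; first exact: smooth_on_det.
apply: smooth_mx_mul => //; last exact: smooth_mx_cst.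
by apply: smooth_mx_mul => //; [exact: smooth_mx_cst|exact: smooth_mx_adj].
Qed.

End InChart.

End LocalReeb.

(** * Existence of a global Reeb field *)

Section GlobalReeb.
Context {R : realType} {n : nat} {M : manifold R n}.
Variables (tau : form_family M 1) (omega : form_family M 2) (r : nat).
Hypothesis twD : doublet_of_class (2 * r + 1) tau omega.

Let tauF : is_form tau. Proof. by case: twD. Qed.
Let omegaF : is_form omega. Proof. by case: twD. Qed.
Let tm x : multilinear (tau x). Proof. by case: tauF => /(_ x)[]. Qed.

(** Condition stable under nonnegative combinations, used to glue local Reeb
    fields; a semi-Reeb field on which tau is positive only has to be
    normalised. *)
Definition semi_reeb (Z : vector_field M) : Prop :=
  [/\ smooth_field Z, forall x, Z x *m gram (omega x) = 0 & forall x, 0 <= tau x (Z x)].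

Lemma form1_0 x : tau x 0 = 0.
Proof. by rewrite covecE // mul0mx mxE. Qed.

Lemma form1Z x s v : tau x (s *: v) = s * tau x v.
Proof. by rewrite !covecE // -scalemxAl mxE. Qed.

Lemma form1D x u v : tau x (u + v) = tau x u + tau x v.
Proof. by rewrite !covecE // mulmxDl mxE. Qed.

(** A local Reeb field multiplied by a bump function and extended by zero.  The
    extension is smooth because the support of the bump is compact, hence closed
    in the Hausdorff space M. *)
Lemma exists_local_reeb x0 : exists2 Z, semi_reeb Z & 1 < tau x0 (Z x0).
Proof.
pose c := chart_at x0; have ac : atlas c := atlas_chart_at x0.
have cx0 : dom c x0 := dom_chart_at x0.
pose y0 := coord c x0; have iy0 : chart_image c y0 := chart_image_coord cx0.
have /nbhs_ballP[e /= e0 eU] : nbhs y0 (chart_image c) := open_nbhs_nbhs (conj (@open_chart_image _ _ _ c) iy0).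
(* Half the radius, so that the closed ball stays in the image of the chart. *)
pose d := e / 2; have d0 : 0 < d by rewrite divr_gt0.
have dU y : `|y0 - y| <= d -> chart_image c y.
  move=> yd; apply: eU; rewrite -ball_normE /=; apply: le_lt_trans yd _.
  by rewrite ltr_pdivrMr // ltr_pMr // ltr1n.
pose K := param c @` [set y | `|y0 - y| <= d].
have Kcl : closed K.
  apply: compact_closed; first exact: manifold_hausdorff.
  apply: continuous_compact.
    apply/continuous_in_subspaceT => y /[1!inE] yd; exact: param_cont (dU y yd).
  apply: bounded_closed_compact.
    exists (`|y0| + d); split; first by rewrite num_real.
    move=> N hN y /= yd; apply: le_trans (ltW hN).
    rewrite -[y](subrKC y0); apply: le_trans (ler_normD _ _) _.
    by rewrite lerD2l distrC.
  have -> : [set y | `|y0 - y| <= d] = closed_ball y0 d by rewrite closed_ballE.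
  exact: closed_ball_closed.
(* This factor makes tau (Z x0) equal to 2, as the local speed is 1 at y0. *)
pose a := 2 / bump y0 d y0; have b0 : 0 < bump y0 d y0 by exact: bump_gt0.
have a0 : 0 < a by rewrite divr_gt0.
pose zc y := (a * bump y0 d y) *: local_reeb tau omega c y0 y.
pose Z (x : M) : 'rV[R]_n := if pselect (dom c x) then zc (coord c x) *m frame_change c (coord c x) else 0.
have ZE x : dom c x -> Z x = zc (coord c x) *m frame_change c (coord c x).
  by rewrite /Z; case: pselect.
have Z0 x : ~ dom c x -> Z x = 0 by rewrite /Z; case: pselect.
have ZK x : ~ K x -> Z x = 0.
  move=> Kx; case: (pselect (dom c x)) => [cx|/Z0//]; rewrite ZE // /zc.
  rewrite bump_eq0 ?mulr0 ?scale0r ?mul0mx // => yd; apply: Kx.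
  by exists (coord c x) => //; exact: coordK.
have Zker x : Z x *m gram (omega x) = 0.
  case: (pselect (dom c x)) => [cx|/Z0 ->]; last by rewrite mul0mx.
  have [h _] := local_reebP twD ac iy0 (chart_image_coord cx); rewrite (coordK cx) in h.
  rewrite ZE // /zc -(scalemxAl (a * bump y0 d (coord c x))).
  by rewrite -(scalemxAl (a * bump y0 d (coord c x))) h scaler0.
have Ztau x : dom c x -> tau x (Z x) =
    a * bump y0 d (coord c x) * local_speed tau omega c y0 (coord c x).
  move=> cx; have [_ h] := local_reebP twD ac iy0 (chart_image_coord cx); rewrite (coordK cx) in h.
  by rewrite ZE // /zc -(scalemxAl (a * bump y0 d (coord c x))) form1Z h.
have Zs : smooth_field Z.
  apply: smooth_field_local => x; case: (pselect (dom c x)) => [cx|Ncx].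
    exists c, (chart_image c); split.
      by split=> //; [exact: open_chart_image|exact: chart_image_coord].
    have zs : smooth_mx_on (chart_image c) zc.
      apply: smooth_mx_scale; [exact: open_chart_image| |exact: (smooth_local_reeb twD ac)].
      apply: (smooth_on_mul (@open_chart_image _ _ _ c) (smooth_on_cst (chart_image c) a)).
      exact/smooth_on_bump/open_chart_image.
    move=> i j k; apply: Ck_eq (zs i j k); first exact: open_chart_image.
    move=> y iy; have [cy yE] := chart_imageP iy.
    have fE : field_coord Z c y = zc y *m frame_change c y *m frame_change_inv c y.
      by rewrite /field_coord (ZE _ cy) yE.
    rewrite fE -(mulmxA (zc y)) (frame_changeK ac iy) mulmx1.
    reflexivity.
  have KNx : ~ K x.
    by move=> [y yd yx]; apply: Ncx; rewrite -yx; have [] := chart_imageP (dU y yd).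
  exists (chart_at x), (chart_preimage (chart_at x) (~` K)); split.
    split; [exact: atlas_chart_at|exact: dom_chart_at|by apply: open_chart_preimage; rewrite openC|by move=> y []|].
    split; first exact/chart_image_coord/dom_chart_at.
    by rewrite /= coordK //; exact: dom_chart_at.
  move=> i j k; apply: (@Ck_eq _ _ _ _ _ (cst 0)).
  - by apply: open_chart_preimage; rewrite openC.
  - by move=> y [iy Ky]; rewrite /field_coord ZK // mul0mx mxE.
  - exact: Ck_cst.
exists Z; first split=> // x.
  case: (pselect (dom c x)) => [cx|/Z0 ->]; last by rewrite form1_0.
  rewrite Ztau // mulr_ge0 ?sqr_ge0 // mulr_ge0 ?bump_ge0 // ltW //.
by rewrite Ztau // local_speed1 mulr1 /a divfK ?lt0r_neq0 // ltr1n.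
Qed.

Lemma open_superlevel (f : M -> R) (a : R) : smooth f -> open [set x | a < f x].
Proof.
move=> fs; rewrite openE => x afx; set c := chart_at x.
have ac : atlas c := atlas_chart_at x.
have cx : dom c x := dom_chart_at x.
pose U := [set y | a < (f \o param c) y].
have Uy : U (coord c x) by rewrite /U /= (coordK cx).
have fc : {for coord c x, continuous (f \o param c)}.
  exact: Ck_continuous (fs c ac 0%N) (chart_image_coord cx).
have nU : nbhs (coord c x) U.
  have na : nbhs ((f \o param c) (coord c x)) [set r : R | a < r].
    by apply: open_nbhs_nbhs; split; [exact: open_gt|exact: Uy].
  exact: (fc _ na).
have nx : nbhs x (coord c @^-1` U) by exact: (coord_cont cx nU).
have nd : nbhs x (dom c) := open_nbhs_nbhs (conj (@open_dom _ _ _ c) cx).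
apply: filterS2 nx nd => z; rewrite /U /= => h cz; by rewrite (coordK cz) in h.
Qed.

Lemma semi_reeb0 : semi_reeb (fun _ => 0).
Proof.
split; first exact: smooth_field0.
- by move=> x; rewrite mul0mx.
- by move=> x; rewrite form1_0.
Qed.

(** A countable basis extracts countably many of the fields of
    [exists_local_reeb]: for each basic open set, keep one field which is good on
    the whole of it, if there is one. *)
Lemma semi_reeb_cover : exists2 z : nat -> vector_field M,
  forall k, semi_reeb (z k) & forall x, exists k, 1 < tau x (z k x).
Proof.
pose W (Z : vector_field M) := [set x | 1 < tau x (Z x)].
have Wo Z : semi_reeb Z -> open (W Z).
  by move=> [Zs _ _]; apply: open_superlevel; exact: smooth_pairing.
have [B Bc [Bo Bb]] := manifold_second_countable M.
have /countable_injP[g ginj] := Bc.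
(* Z is a good choice for the basic open set with number k, if there is any. *)
pose P k (Z : vector_field M) := semi_reeb Z /\
  (forall b, B b -> g b = k -> (exists2 Z', semi_reeb Z' & b `<=` W Z') -> b `<=` W Z).
have ex k : exists Z, P k Z.
  have [[b [Bbb gb [Z' Z's bZ']]]|h] := pselect (exists b, [/\ B b, g b = k & exists2 Z', semi_reeb Z' & b `<=` W Z']).
    exists Z'; split=> // b' Bb' gb' _.
    have <- : b = b' by apply: ginj; rewrite ?inE // gb gb'.
    exact: bZ'.
  exists (fun _ => 0); split; first exact: semi_reeb0.
  by move=> b Bbb gb ex; exfalso; apply: h; exists b.
have [z zP] := choice ex.
exists z => [k|x]; first by have [] := zP k.
have [Z Zs Zx] := exists_local_reeb x.
have [b [Bbb bx] bW] := Bb x (W Z) (open_nbhs_nbhs (conj (Wo Z Zs) Zx)).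
exists (g b); have [_ h] := zP (g b).
by apply: (h b) => //; exists Z.
Qed.

(** The fields z k of [semi_reeb_cover] are summed with weights rho k, where
    rho (k+1) = rho k * h (1 - tau (z k)) and h is smooth, positive on the positive
    half-line and zero elsewhere.  On the open set tau (z k) > 1 all weights after
    the k-th vanish, so that the sum is locally finite without any refinement of
    the cover.  The weight can only drop to zero at a step which adds a vector with
    tau > 0; thus tau is positive on the sum, which is then normalised. *)
Lemma exists_reeb : exists X, reeb tau omega X.
Proof.
have [z zs zc] := semi_reeb_cover.
pose t k x := tau x (z k x).
have ts k : smooth (t k) by have [h _ _] := zs k; exact: smooth_pairing.
have t0 k x : 0 <= t k x by have [_ _ h] := zs k; exact: h.
pose rho := fix rho k (x : M) : R :=
  if k is k'.+1 then rho k' x * flat 1 (1 + (-1) * t k' x) else 1.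
have rhos k : smooth (rho k).
  elim: k => [|k IH] /=; first exact: smooth_cst.
  by apply: smooth_mul => //; apply/smooth_flat/smooth_affine.
have rho0 k x : 0 <= rho k x.
  by elim: k => [|k IH] //=; rewrite mulr_ge0 // flat_ge0.
pose Y := fix Y k (x : M) : 'rV[R]_n :=
  if k is k'.+1 then Y k' x + rho k' x *: z k' x else 0.
have Ys k : smooth_field (Y k).
  elim: k => [|k IH] /=; first exact: smooth_field0.
  by apply: smooth_field_add => //; apply: smooth_field_scale => //; have [] := zs k.
have Yker k x : Y k x *m gram (omega x) = 0.
  elim: k => [|k IH] /=; first by rewrite mul0mx.
  have [_ zk _] := zs k.
  by rewrite mulmxDl IH -scalemxAl zk scaler0 addr0.
have Ytau k x : tau x (Y k.+1 x) = tau x (Y k x) + rho k x * t k x.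
  by rewrite /= form1D form1Z.
have Yge0 k x : 0 <= tau x (Y k x).
  by elim: k => [|k IH]; [rewrite /= form1_0|rewrite Ytau addr_ge0 // mulr_ge0].
have pos k x : 0 < rho k x \/ 0 < tau x (Y k x).
  elim: k => [|k [IH|IH]]; first by left.
    have [tk|tk] := ltP (t k x) 1.
      by left; rewrite /= mulr_gt0 // flat_gt0 // mulN1r subr_gt0.
    right; rewrite Ytau ltr_wpDl // mulr_gt0 //; exact: lt_le_trans ltr01 tk.
  by right; rewrite Ytau ltr_pwDl // mulr_ge0.
(* The partial sums are stationary where some tau (z k) exceeds 1. *)
have stab k x m : 1 < t k x -> (k < m)%N -> rho m x = 0 /\ Y m x = Y k.+1 x.
  move=> tk; elim: m => // m IH; rewrite ltnS leq_eqVlt => /orP[/eqP <-|km].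
    by split=> //=; rewrite flat_le0 ?mulr0 // mulN1r subr_le0 ltW.
  by have [r0 Y0] := IH km; split; rewrite /= r0 ?mul0r // scale0r addr0.
have [N NP] := choice zc.
pose Yl x := Y (N x).+1 x.
have YlE k x : 1 < t k x -> Yl x = Y k.+1 x.
  move=> tk; have [_ e1] := stab k x (maxn k (N x)).+1 tk (leq_maxl k (N x)).
  have [_ e2] := stab (N x) x (maxn k (N x)).+1 (NP x) (leq_maxr k (N x)).
  by rewrite -e1 e2.
have Ylpos x : 0 < tau x (Yl x).
  have [] := pos (N x).+1 x => //.
  by have [-> _] := stab (N x) x _ (NP x) (ltnSn _); rewrite ltxx.
have Yls : smooth_field Yl.
  apply: smooth_field_local => x; set c := chart_at x.
  have ac : atlas c := atlas_chart_at x.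
  have cx : dom c x := dom_chart_at x.
  pose W := [set p | 1 < t (N x) p].
  have Wo : open W by exact: open_superlevel.
  exists c, (chart_preimage c W); split.
    split=> //; [exact: open_chart_preimage|by move=> y []|].
    by split; [exact: chart_image_coord|rewrite /W /= (coordK cx); exact: NP].
  have h := smooth_field_elim ac (Ys (N x).+1).
  move=> i j k; apply: (@Ck_eq _ _ _ _ _ (fun y => field_coord (Y (N x).+1) c y i j)).
  - exact: open_chart_preimage.
  - move=> y [iy Wy].
    exact: (congr1 (fun u : 'rV[R]_n => (u *m change (chart_at (param c y)) c (param c y)) i j) (esym (YlE _ _ Wy))).
  - by apply: Ck_sub (h i j k) => y [].
exists (fun x => (tau x (Yl x))^-1 *: Yl x); split.
- apply: smooth_field_scale => //; apply: smooth_inv; last exact: smooth_pairing.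
  by move=> x; rewrite lt0r_neq0.
- by move=> x; rewrite form1Z mulVf // lt0r_neq0.
- move=> x A; rewrite /contract.
  have wm : multilinear (omega x) by case: omegaF => /(_ x)[].
  by apply: (ker_gramP _ wm).1; rewrite -scalemxAl Yker scaler0.
Qed.

End GlobalReeb.

Local Close Scope classical_set_scope.

(** * The equivalence *)

Theorem proposition6p11 (R : realType) (n : nat) (M : manifold R n) (r : nat)
    (tau : form_family M 1) (omega : form_family M 2)
    (Hdoublet : doublet_of_class (2 * r + 1) tau omega)
    (f : M -> R) (Hf : smooth f) :
  doublet_of_class (2 * r + 1)
    (form_scale (fun x => expR (f x)) tau)
    (form_scale (fun x => expR (f x)) (form_add (wedge (differential f) tau) omega))
  <->
  forall X : vector_field M, reeb tau omega X ->
    form_scale (fun x => differential f x (X x)) (wedge tau (wedge_pow omega r))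
    = wedge (differential f) (wedge_pow omega r).
Proof.
have [tauF omegaF cl] := Hdoublet.
have dF : is_form (differential f) by exact: is_form_differential.
have tm x : multilinear (tau x) by have [/(_ x)[]] := tauF.
have wm x : multilinear (omega x) by have [/(_ x)[]] := omegaF.
have dm x : multilinear (differential f x) by have [/(_ x)[]] := dF.
have wa x : antisym (omega x) by exact: is_form_antisym.
have scaledE x : form_scale (fun x => expR (f x)) (form_add (wedge (differential f) tau) omega) x =
    (fun A => expR (f x) * (wedge_at (differential f x) (tau x) A + omega x A)).
  by apply/funext => A; rewrite /form_scale /form_add wedgeE.
have classP x := pointwise_class (tm x) (wm x) (wa x) (cl x) (differential f x) (c := expR (f x))
  (lt0r_neq0 (expR_gt0 _)).
have equationP X x (XR : reeb tau omega X) := pointwise_equation (tm x) (wm x) (wa x) (cl x) (dm x)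
  (X := X x) ((ker_gramP (X x) (wm x)).2 (fun u => let: And3 _ _ k := XR in k x u))
  (let: And3 _ t _ := XR in t x).
have eqE X x A : form_scale (fun x => differential f x (X x)) (wedge tau (wedge_pow omega r)) x A =
    differential f x (X x) * wedge_at (tau x) (wedge_pow_at (omega x) r) A.
  by rewrite /form_scale wedgeE wedge_powE.
split=> [[_ _ cl'] X XR|h].
  apply: functional_extensionality_dep => x; apply/funext => A.
  rewrite eqE wedgeE wedge_powE; apply: (equationP X x XR).2.
  by apply/classP; have := cl' x; rewrite scaledE.
have [X XR] := exists_reeb Hdoublet.
split.
- exact: is_form_scale (smooth_expR Hf) tauF.
- exact: is_form_scale (smooth_expR Hf) (is_form_add (is_form_wedge dF tauF) omegaF).
move=> x; rewrite scaledE; apply/classP/(equationP X x XR) => A.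
by rewrite -eqE (h X XR) wedgeE wedge_powE.
Qed.
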